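(* Let $$U_{2t}(q)=\frac{\sum_{n\geq0}(-1)^n(2n+1)^{2t+1}q^{\frac{n(n+1)}2}}{\sum_{n\geq0}(-1)^n(2n+1)q^{\frac{n(n+1)}2}},\qquad V_{2t}(q)=\frac{\sum_{n=-\infty}^{\infty}(-1)^n(6n+1)^{2t}q^{\frac{n(3n+1)}2}}{\sum_{n=-\infty}^{\infty}(-1)^n q^{\frac{n(3n+1)}2}}.$$ Then, as power series in $X$: (1) $$\sum_{t\geq0} (-1)^t U_{2t}(q)\cdot \frac{X^{2t+1}}{(2t+1)!}=\sin X \cdot \prod_{j\geq1}\left[1+\frac{4(\sin^2X)q^j}{(1-q^j)^2}\right];$$ (2) $$\sum_{t\geq0} (-1)^t V_{2t}(q)\cdot \frac{X^{2t}}{(2t)!}=\cos X \cdot\prod_{j\geq1}\left[1-\frac{4(\sin^2X)q^j}{(1+q^j)^2}\right]\left[1+\frac{4(\sin^22X)q^{2j-1}}{(1-q^{2j-1})^2}\right].$$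
   Context: All series are formal power series in $q$ and $X$. *)

(* Defs.v *)
From HB Require Import structures.
From mathcomp Require Import all_boot all_order all_algebra.
From mathcomp Require Import finmap zify.
From mathcomp Require Import boolp classical_sets functions cardinality fsbigop.

Set Implicit Arguments.
Unset Strict Implicit.
Unset Printing Implicit Defensive.

Import Order.TTheory GRing.Theory Num.Theory.
Local Open Scope classical_set_scope.
Local Open Scope ring_scope.

(* [p n] is the coefficient of degree n of p : {fps R}; Q[[q]][[X]] is rendered
   as {fps {fps rat}}, in which [p m n] is the coefficient of X^m q^n. *)
Record fps (R : Type) := Fps { fps_coef :> nat -> R }.

Notation "{ 'fps' R }" := (fps R) (at level 0, format "{ 'fps'  R }").
Notation "\fps_ ( i ) E" := (Fps (fun i : nat => E))
  (at level 36, E at level 36, i at level 50, format "\fps_ ( i )  E").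

HB.instance Definition _ (R : Type) := gen_eqMixin (fps R).
HB.instance Definition _ (R : Type) := gen_choiceMixin (fps R).

Lemma fpsP (R : Type) (p q : {fps R}) : p =1 q -> p = q.
Proof. by case: p q => [p] [q] /= /funext ->. Qed.

Section Zmodule.
Variable R : zmodType.
Implicit Types p q : {fps R}.

Definition fps_zero : {fps R} := \fps_(i) 0.
Definition fps_opp p : {fps R} := \fps_(i) - p i.
Definition fps_add p q : {fps R} := \fps_(i) (p i + q i).

Fact fps_addA : associative fps_add.
Proof. by move=> p q r; apply: fpsP => i /=; rewrite addrA. Qed.
Fact fps_addC : commutative fps_add.
Proof. by move=> p q; apply: fpsP => i /=; rewrite addrC. Qed.
Fact fps_add0 : left_id fps_zero fps_add.
Proof. by move=> p; apply: fpsP => i /=; rewrite add0r. Qed.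
Fact fps_addN : left_inverse fps_zero fps_opp fps_add.
Proof. by move=> p; apply: fpsP => i /=; rewrite addNr. Qed.

HB.instance Definition _ :=
  GRing.isZmodule.Build (fps R) fps_addA fps_addC fps_add0 fps_addN.

Lemma fps0E i : (0 : {fps R}) i = 0. Proof. by []. Qed.
Lemma fpsNE p i : (- p) i = - p i. Proof. by []. Qed.
Lemma fpsDE p q i : (p + q) i = p i + q i. Proof. by []. Qed.
Lemma fpsBE p q i : (p - q) i = p i - q i. Proof. by []. Qed.
Lemma fps_bigE I (r : seq I) (P : pred I) (F : I -> {fps R}) i :
  (\sum_(k <- r | P k) F k) i = \sum_(k <- r | P k) F k i.
Proof. exact: (big_morph (fun p : {fps R} => p i)). Qed.

End Zmodule.

Section Ring.
Variable R : comNzRingType.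
Implicit Types p q r : {fps R}.

Definition fpsC (c : R) : {fps R} := \fps_(i) (if i == 0%N then c else 0).
Definition fpsX : {fps R} := \fps_(i) (i == 1%N)%:R.
Definition fps_mul p q : {fps R} := \fps_(i) \sum_(j < i.+1) p j * q (i - j)%N.

Fact fps_mulC : commutative fps_mul.
Proof.
move=> p q; apply: fpsP => i /=; rewrite (reindex_inj rev_ord_inj) /=.
by apply: eq_bigr => j _; rewrite subSS mulrC subKn // -ltnS.
Qed.

Fact fps_mul_rev p q i : fps_mul p q i = \sum_(j < i.+1) p (i - j)%N * q j.
Proof. by rewrite fps_mulC /=; apply: eq_bigr => j _; rewrite mulrC. Qed.

Fact fps_mulA : associative fps_mul.
Proof.
move=> p q r; apply: fpsP => i; rewrite [RHS]fps_mul_rev.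
pose coef3 j k := p j * (q (i - j - k)%N * r k).
transitivity (\sum_(j < i.+1) \sum_(k < i.+1 | (k <= i - j)%N) coef3 j k).
  apply: eq_bigr => j _; rewrite fps_mul_rev big_distrr /=.
  by rewrite (big_ord_narrow_leq (leq_subr _ _)).
rewrite (exchange_big_dep predT) //=; apply: eq_bigr => k _.
transitivity (\sum_(j < i.+1 | (j <= i - k)%N) coef3 j k).
  apply: eq_bigl => j; rewrite -ltnS -(ltnS j) -!subSn ?leq_ord //.
  by rewrite -subn_gt0 -(subn_gt0 j) -!subnDA addnC.
rewrite (big_ord_narrow_leq (leq_subr _ _)) big_distrl /=.
by apply: eq_bigr => j _; rewrite /coef3 -!subnDA addnC mulrA.
Qed.

Fact fps_mul1 : left_id (fpsC 1) fps_mul.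
Proof.
move=> p; apply: fpsP => i /=.
by rewrite big_ord_recl /= mul1r subn0 big1 ?addr0 // => j _; rewrite mul0r.
Qed.

Fact fps_mulDl : left_distributive fps_mul +%R.
Proof.
move=> p q r; apply: fpsP => i /=; rewrite -big_split.
by apply: eq_bigr => j _; rewrite mulrDl.
Qed.

Fact fps_oner_neq0 : fpsC 1 != 0.
Proof.
by apply/eqP => /(congr1 (fun p : {fps R} => p 0%N)) /eqP; rewrite /= oner_eq0.
Qed.

HB.instance Definition _ := GRing.Zmodule_isComNzRing.Build (fps R)
  fps_mulA fps_mulC fps_mul1 fps_mulDl fps_oner_neq0.

Lemma fps1E i : (1 : {fps R}) i = (i == 0%N)%:R.
Proof. by case: i. Qed.
Lemma fpsME p q i : (p * q) i = \sum_(j < i.+1) p j * q (i - j)%N.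
Proof. by []. Qed.

Lemma fpsM0E p q : (p * q) 0%N = p 0%N * q 0%N.
Proof. by rewrite fpsME big_ord1. Qed.

Lemma fpsX0E p n : (p ^+ n) 0%N = p 0%N ^+ n.
Proof. by elim: n => [|n IHn]; rewrite ?fps1E // !exprS fpsM0E IHn. Qed.

Lemma fps_natE n i : (n%:R : {fps R}) i = if i == 0%N then n%:R else 0.
Proof.
by elim: n => [|n IHn]; rewrite ?fps0E ?if_same // -addn1 !natrD fpsDE IHn fps1E;
   case: eqP; rewrite ?addr0.
Qed.

Fact fpsC_is_zmod_morphism : zmod_morphism fpsC.
Proof. by move=> a b; apply: fpsP => -[|i] //=; rewrite subr0. Qed.
Fact fpsC_is_monoid_morphism : monoid_morphism fpsC.
Proof.
split=> // a b; apply: fpsP => -[|i]; rewrite fpsME ?big_ord1 //.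
rewrite big1 // => -[[|j] ltj] _ /=; first by rewrite mulr0.
by rewrite mul0r.
Qed.
HB.instance Definition _ :=
  GRing.isZmodMorphism.Build R (fps R) fpsC fpsC_is_zmod_morphism.
HB.instance Definition _ :=
  GRing.isMonoidMorphism.Build R (fps R) fpsC fpsC_is_monoid_morphism.

Lemma fpsXnE n i : (fpsX ^+ n) i = (i == n)%:R.
Proof.
elim: n i => [|n IHn] i; first by rewrite fps1E.
rewrite exprS fpsME; case: i => [|i].
  by rewrite big_ord1 /= mul0r.
rewrite 2!big_ord_recl /= mul0r add0r mul1r big1 ?addr0; last first.
  by move=> j _; rewrite mul0r.
by rewrite IHn subSS subn0 eqSS.
Qed.

Lemma fps_lowM n p q : (forall m, (m < n)%N -> p m = 0) ->
  forall m, (m < n)%N -> (p * q) m = 0.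
Proof.
move=> p0 m ltmn; rewrite fpsME big1 // => j _.
by rewrite p0 ?mul0r // (leq_trans _ ltmn).
Qed.

Lemma fps_lowX p n : p 0%N = 0 -> forall m, (m < n)%N -> (p ^+ n) m = 0.
Proof.
move=> p0; elim: n => // n IHn m; rewrite ltnS exprS fpsME => lemn.
rewrite big1 // => -[[|j] ltj] _ /=; first by rewrite p0 mul0r.
by rewrite IHn ?mulr0 //; move: ltj lemn; rewrite ltnS; lia.
Qed.

Lemma fpsCME c p i : (fpsC c * p) i = c * p i.
Proof.
rewrite fpsME big_ord_recl /= subn0 big1 ?addr0 // => j _.
by rewrite mul0r.
Qed.

End Ring.

Arguments fpsX {R}.

Section UnitRing.
Variable R : comUnitRingType.
Implicit Types p q : {fps R}.

Definition fps_unit : {pred {fps R}} := [pred p : {fps R} | p 0%N \is a GRing.unit].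

(* The first n coefficients of the inverse of p. *)
Fixpoint fps_inv_seq p (n : nat) : seq R :=
  if n is m.+1 then
    let s := fps_inv_seq p m in
    rcons s ((p 0%N)^-1 * ((m == 0%N)%:R - \sum_(j < m) s`_j * p (m - j)%N))
  else [::].

Definition fps_inv p : {fps R} :=
  if p \in fps_unit then \fps_(i) (fps_inv_seq p i.+1)`_i else p.

Fact size_fps_inv_seq p n : size (fps_inv_seq p n) = n.
Proof. by elim: n => //= n IHn; rewrite size_rcons IHn. Qed.

Fact nth_fps_inv_seq p n i :
  (i < n)%N -> (fps_inv_seq p n)`_i = (fps_inv_seq p i.+1)`_i.
Proof.
elim: n => // n IHn; rewrite ltnS leq_eqVlt => /predU1P[-> // | ltin].
by rewrite [LHS]/= nth_rcons size_fps_inv_seq ltin IHn.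
Qed.

Fact fps_mulV : {in fps_unit, left_inverse 1 fps_inv *%R}.
Proof.
move=> p Up; apply: fpsP => i; rewrite fpsME fps1E big_ord_recr /= subnn.
rewrite /fps_inv Up /= nth_rcons size_fps_inv_seq ltnn eqxx mulrAC mulVr // mul1r.
rewrite addrC -[RHS](subrK (\sum_(j < i) (fps_inv_seq p i)`_j * p (i - j)%N)).
congr (_ + _); apply: eq_bigr => j _; congr (_ * _).
by rewrite (nth_fps_inv_seq _ (ltn_ord j)).
Qed.

Fact fps_unitPl p q : q * p = 1 -> fps_unit p.
Proof.
move/(congr1 (fun r : {fps R} => r 0%N)); rewrite fpsM0E fps1E => qp1.
by apply/unitrP; exists (q 0%N); split=> //; rewrite mulrC.
Qed.

Fact fps_inv_out : {in [predC fps_unit], fps_inv =1 id}.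
Proof. by move=> p Up; rewrite /fps_inv ifN. Qed.

HB.instance Definition _ := GRing.ComNzRing_hasMulInverse.Build (fps R)
  fps_mulV fps_unitPl fps_inv_out.

Lemma fps_unitE p : (p \is a GRing.unit) = (p 0%N \is a GRing.unit).
Proof. by []. Qed.

End UnitRing.

(* Sum of a family of formal power series. [\sum_(i \in A) x i] is the sum of
   the nonzero x i, and 0 when there are infinitely many of them, so that the
   definition is meaningful for [fps_summable] families. *)
Section Sum.
Variables (R : zmodType) (I : choiceType).

Definition fps_summable (F : I -> {fps R}) :=
  forall m, finite_set [set i | F i m != 0].

Definition fps_sum (F : I -> {fps R}) : {fps R} :=
  \fps_(m) \sum_(i \in [set: I]) F i m.

Lemma fps_sum_coef (F : I -> {fps R}) (A : {fset I}) m :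
  (forall i, i \notin A -> F i m = 0) -> fps_sum F m = \sum_(i <- A) F i m.
Proof. exact: fsbigTE. Qed.

End Sum.

Lemma fps_summable_nat (R : zmodType) (F : nat -> {fps R}) :
  (forall n m, (m < n)%N -> F n m = 0) -> fps_summable F.
Proof.
move=> F0 m; apply: (sub_finite_set _ (finite_II m.+1)) => n /=.
by rewrite ltnS leqNgt; apply: contraNN => /F0 ->.
Qed.

Lemma fps_summable_int (R : zmodType) (F : int -> {fps R}) :
  (forall n m, (m < `|n|)%N -> F n m = 0) -> fps_summable F.
Proof.
move=> F0 m.
have fin : finite_set ((Posz @` `I_m.+1) `|` (Negz @` `I_m.+1)).
  by rewrite finite_setU; split; apply/finite_image/finite_II.
apply: sub_finite_set fin => n /=.
have [/F0 -> | lenm _] := ltnP m `|n|%N; first by rewrite eqxx.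
by case: n lenm => n lenm; [left | right]; exists n => //=; lia.
Qed.

(* Limit in Q[[X, q]] for coefficientwise convergence: each coefficient is the
   eventual value of the sequence of coefficients, and 0 if there is none. *)
Section Limit.
Variable R : comNzRingType.
Implicit Types (u F : nat -> {fps {fps R}}) (l : {fps {fps R}}).

Definition fps2_cvg_to u l :=
  forall m n, exists N, forall k, (N <= k)%N -> u k m n = l m n.

Definition fps2_lim u : {fps {fps R}} :=
  \fps_(m) \fps_(n)
    xget 0 [set c : R | exists N, forall k, (N <= k)%N -> u k m n = c].

Lemma fps2_limP u l : fps2_cvg_to u l -> fps2_lim u = l.
Proof.
move=> ul; apply: fpsP => m; apply: fpsP => n /=.
apply: xget_unique => [|c [N cN]]; first exact: ul.
by have [M lM] := ul m n; rewrite -(cN (maxn N M)) ?lM ?leq_maxl ?leq_maxr.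
Qed.

(* The infinite product of the F j over j >= 1. *)
Definition fps2_prod F : {fps {fps R}} :=
  fps2_lim (fun N => \prod_(1 <= j < N.+1) F j).

Lemma fps2_prodP F :
  (forall j m n, (n < j)%N -> (F j - 1) m n = 0) ->
  fps2_cvg_to (fun N => \prod_(1 <= j < N.+1) F j) (fps2_prod F).
Proof.
move=> F1; set u := fun N => _.
have stab m n k : (n <= k)%N -> u k m n = u n m n.
  elim: k => [|k IHk]; first by rewrite leqn0 => /eqP ->.
  rewrite leq_eqVlt => /predU1P[-> // | lenk]; rewrite -IHk //.
  have -> : u k.+1 = u k * (F k.+1 - 1) + u k.
    by rewrite /u big_nat_recr //= mulrBr mulr1 subrK.
  rewrite !fpsDE.
  rewrite [X in X + _](_ : _ = 0) ?add0r // fpsME fps_bigE big1 // => i _.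
  by rewrite mulrC; apply: (fps_lowM (n := k.+1)) => // r; apply: F1.
pose l : {fps {fps R}} := \fps_(m) \fps_(n) u n m n.
have ul : fps2_cvg_to u l by move=> m n; exists n => k; apply: stab.
by rewrite /fps2_prod (fps2_limP ul).
Qed.

End Limit.

Section Trigo.
Variable R : comUnitRingType.

(* Meaningful when p has constant coefficient 0. *)
Definition fps_sin (p : {fps R}) : {fps R} :=
  fps_sum (fun t : nat => (-1) ^+ t * (p ^+ (2 * t + 1) / ((2 * t + 1)`!)%:R)).

Definition fps_cos (p : {fps R}) : {fps R} :=
  fps_sum (fun t : nat => (-1) ^+ t * (p ^+ (2 * t) / ((2 * t)`!)%:R)).

Lemma fps_sin_summable (c : nat -> {fps R}) (p : {fps R}) : p 0%N = 0 ->
  fps_summable (fun t : nat =>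
    c t * (p ^+ (2 * t + 1) / ((2 * t + 1)`!)%:R)).
Proof.
move=> p0; apply: fps_summable_nat => t m ltmt; rewrite mulrCA.
by apply: (fps_lowM _ (fps_lowX (n := (2 * t + 1)%N) p0)); lia.
Qed.

Lemma fps_cos_summable (c : nat -> {fps R}) (p : {fps R}) : p 0%N = 0 ->
  fps_summable (fun t : nat => c t * (p ^+ (2 * t) / ((2 * t)`!)%:R)).
Proof.
move=> p0; apply: fps_summable_nat => t m ltmt; rewrite mulrCA.
by apply: (fps_lowM _ (fps_lowX (n := (2 * t)%N) p0)); lia.
Qed.

End Trigo.

(* [U2 t] and [V2 t] are the series U_{2t}(q) and V_{2t}(q). *)
Definition U2 (t : nat) : {fps rat} :=
  fps_sum (fun n : nat =>
    (-1) ^+ n * (2 * n + 1)%:R ^+ (2 * t + 1) * fpsX ^+ (n * (n + 1) %/ 2)) /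
  fps_sum (fun n : nat =>
    (-1) ^+ n * (2 * n + 1)%:R * fpsX ^+ (n * (n + 1) %/ 2)).

(* The exponent n(3n+1)/2 is a nonnegative integer, so that [^] is here an
   ordinary power of the indeterminate. *)
Definition V2 (t : nat) : {fps rat} :=
  fps_sum (fun n : int =>
    (-1) ^ n * (6 * n + 1)%:~R ^+ (2 * t) * fpsX ^ (n * (3 * n + 1) %/ 2)%Z) /
  fps_sum (fun n : int =>
    (-1) ^ n * fpsX ^ (n * (3 * n + 1) %/ 2)%Z).

Lemma U2_summable (c : nat -> {fps rat}) :
  fps_summable (fun n : nat => c n * fpsX ^+ (n * (n + 1) %/ 2)).
Proof.
apply: fps_summable_nat => n m ltmn; rewrite mulrC.
apply: (fps_lowM _ (fps_lowX (n := (n * (n + 1) %/ 2)%N) _)) => //.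
by rewrite (leq_trans ltmn) // leq_divRL //; nia.
Qed.

Lemma pentagonal_ge (n : int) :
  exists2 k : nat, (`|n| <= k)%N & (n * (3 * n + 1) %/ 2)%Z = k.
Proof.
have le_n : `|n|%N%:Z <= (n * (3 * n + 1) %/ 2)%Z by rewrite lez_divRL //; nia.
by exists `|(n * (3 * n + 1) %/ 2)%Z|%N; lia.
Qed.

Lemma V2_summable (c : int -> {fps rat}) :
  fps_summable (fun n : int => c n * fpsX ^ (n * (3 * n + 1) %/ 2)%Z).
Proof.
apply: fps_summable_int => n m ltmn; rewrite mulrC.
have [k lenk ->] := pentagonal_ge n; rewrite -exprnP.
by apply: (fps_lowM _ (fps_lowX (n := k) _)) => //; apply: leq_trans lenk.
Qed.

Lemma U2_unit : fps_sum (fun n : nat =>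
  (-1) ^+ n * (2 * n + 1)%:R * fpsX ^+ (n * (n + 1) %/ 2) : {fps rat})
  \is a GRing.unit.
Proof.
rewrite fps_unitE (fps_sum_coef (A := [fset 0%N]%fset)) => [|n].
  by rewrite big_seq_fset1 !expr0 !mul1r.
rewrite inE => n0; rewrite mulrC; apply: (fps_lowM (n := n)); last by lia.
move=> m ltmn; apply: fps_lowX => //.
by rewrite (leq_trans ltmn) // leq_divRL //; nia.
Qed.

Lemma V2_unit : fps_sum (fun n : int =>
  (-1) ^ n * fpsX ^ (n * (3 * n + 1) %/ 2)%Z : {fps rat}) \is a GRing.unit.
Proof.
rewrite fps_unitE (fps_sum_coef (A := [fset 0 : int]%fset)) => [|n].
  by rewrite big_seq_fset1 !expr0z mul1r.
rewrite inE => n0; have [k lenk ->] := pentagonal_ge n; rewrite -exprnP mulrC.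
apply: (fps_lowM _ (fps_lowX (n := k) _)) => //.
by apply: leq_trans lenk; rewrite absz_gt0.
Qed.

Lemma fps2_nat_unit n : (n.+1%:R : {fps {fps rat}}) \is a GRing.unit.
Proof. by rewrite !fps_unitE !fps_natE unitfE pnatr_eq0. Qed.

Section Products.
Let q : {fps {fps rat}} := fpsC fpsX.

Lemma fps2_1qn_unit j : (0 < j)%N ->
  (1 - q ^+ j \is a GRing.unit) && (1 + q ^+ j \is a GRing.unit).
Proof.
move=> j_gt0; rewrite !fps_unitE !fpsBE !fpsDE -rmorphXn /= !fpsXnE.
by rewrite ltn_eqF // subr0 addr0 unitr1.
Qed.

Lemma fps2_low_qM (p r : {fps {fps rat}}) j k m n :
  (n < k)%N -> (k <= j)%N -> (p * q ^+ j * r) m n = 0.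
Proof.
move=> ltnk lekj; have -> : q ^+ j = fpsC (fpsX ^+ j) by rewrite rmorphXn.
rewrite mulrAC mulrC fpsCME.
by apply: (fps_lowM _ (fps_lowX (n := j) _)) => //; apply: leq_trans lekj.
Qed.

Lemma fps2_prod_cvg1 (a : {fps {fps rat}}) :
  let F j := 1 + 4 * a * q ^+ j / (1 - q ^+ j) ^+ 2 in
  fps2_cvg_to (fun N => \prod_(1 <= j < N.+1) F j) (fps2_prod F).
Proof.
move=> F; apply: fps2_prodP => j m n ltnj.
by rewrite /F addrAC subrr add0r (fps2_low_qM _ _ _ ltnj).
Qed.

Lemma fps2_prod_cvg2 (a b : {fps {fps rat}}) :
  let F j := (1 - 4 * a * q ^+ j / (1 + q ^+ j) ^+ 2) *
    (1 + 4 * b * q ^+ (2 * j - 1) / (1 - q ^+ (2 * j - 1)) ^+ 2) in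
  fps2_cvg_to (fun N => \prod_(1 <= j < N.+1) F j) (fps2_prod F).
Proof.
move=> F; apply: fps2_prodP => j m n ltnj; rewrite /F.
have E A B : (1 - A) * (1 + B) - 1 = - A + B * (1 - A) :> {fps {fps rat}}.
  by rewrite mulrDr mulr1 [_ * B]mulrC addrAC [1 - A - 1]addrAC subrr add0r.
rewrite E !fpsDE !fpsNE (fps2_low_qM _ _ _ ltnj) //.
rewrite oppr0 add0r -(mulrA _ (_ ^-1)).
by rewrite (fps2_low_qM _ _ _ ltnj) //; lia.
Qed.

End Products.

(* Main.v *)
Require Import Defs.
From mathcomp Require Import all_boot all_order all_algebra.
From mathcomp Require Import zify ring finmap.
From mathcomp Require Import boolp classical_sets functions cardinality fsbigop.

(* The products over j <= N are expanded by the finite Jacobi triple product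
   (a form of the q-binomial theorem), applied to any sequence e with
   e(n + 1) + e(n - 1) = c e(n), here sin((2n + 1)X), cos((2n + 1)X) or
   cos(4nX) up to signs.  Once multiplied by their powers of q, the q-binomial
   coefficients agree modulo q^N with the central one, hence the finite product
   is, modulo q^N, a series free of X times the theta series.  That factor need
   not be evaluated: it is eliminated by comparing the coefficients of X (for U)
   or of 1 (for V).

   For V, this leaves a product of two theta series.  Its coefficient of
   cos((2l + 1)X) is sum_n (-1)^n q^(n^2 + (l - 2n)(l - 2n + 1)/2); it
   vanishes for l = 1 mod 3, and otherwise a shift of n turns it into a
   pentagonal power of q times a series independent of l, which is the
   quintuple product identity up to the irrelevant factor again. *)

Set Implicit Arguments.
Unset Strict Implicit.
Unset Printing Implicit Defensive.

Import Order.TTheory GRing.Theory Num.Theory.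
Local Open Scope ring_scope.

(** * q-binomial coefficients and the finite triple product *)

Section QBinomial.
Variable R : comNzRingType.
Implicit Types (q p c : R).

(** The Gaussian binomial coefficients, given by a Pascal rule rather than as quotients, so that
    they make sense in any commutative ring. *)
Fixpoint qbin q (n k : nat) : R :=
  match n, k with
  | _, 0 => 1
  | 0, _.+1 => 0
  | n'.+1, k'.+1 => qbin q n' k' + q ^+ k'.+1 * qbin q n' k'.+1
  end.

Lemma qbin0 q n : qbin q n 0 = 1.
Proof. by case: n. Qed.

Lemma qbinS q n k :
  qbin q n.+1 k.+1 = qbin q n k + q ^+ k.+1 * qbin q n k.+1.
Proof. by []. Qed.

Lemma qbin_small q n k : (n < k)%N -> qbin q n k = 0.
Proof.
elim: n k => [|n IHn] [|k] //= ltnk; rewrite !IHn ?mulr0 ?addr0 //; lia.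
Qed.

(** The mirror Pascal rule, by induction from the defining one. For k > n the truncated exponent is
    harmless, as [qbin q n k] vanishes. *)
Lemma qbinS' q n k :
  qbin q n.+1 k.+1 = q ^+ (n - k) * qbin q n k + qbin q n k.+1.
Proof.
elim: n k => [|n IHn] k; first by case: k => [|k] /=; rewrite !(mulr0, mulr1).
case: k => [|k].
  rewrite (qbinS q n.+1) {1}IHn.
  rewrite (qbinS q n) !qbin0 !subn0 (exprS q n); ring.
have [lt_nk | le_kn] := ltnP n k.+1.
  rewrite qbinS [qbin q n.+1 k.+2]qbin_small ?ltnS // mulr0 !addr0.
  by rewrite (_ : n.+1 - k.+1 = 0)%N ?mul1r //; lia.
rewrite qbinS {1}(IHn k) {1}(IHn k.+1) (qbinS q n k) (qbinS q n k.+1).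
rewrite subSS mulrDr mulrA -exprD (_ : k.+2 + (n - k.+1) = n - k + k.+1)%N; last by lia.
rewrite exprD; ring.
Qed.

(** A new factor 1 + c x + x^2 of the triple product raises the upper index by two: the term in k +
    1 comes from 1 + x^2, the two others from c x. *)
Lemma qbin_add2 q n k : (k <= n)%N ->
  qbin q n.+2 k.+2 = (1 + q ^+ n.+1) * qbin q n k.+1
    + q ^+ k.+2 * qbin q n k.+2 + q ^+ (n - k) * qbin q n k.
Proof.
move=> le_kn; rewrite qbinS !qbinS'.
(* For k = n the truncated [n - k.+1] yields q^(n + 2) instead of q^(n + 1); the correction
   multiplies [qbin q n n.+1], which is 0. *)
have -> : q ^+ n.+1 = q ^+ k.+2 * q ^+ (n - k.+1) + (k == n)%:R * (q ^+ n.+1 - q ^+ k.+2).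
  case: eqVneq => [->|nkn]; last first.
    by rewrite mul0r addr0 -exprD; congr (_ ^+ _); lia.
  by rewrite (_ : n - n.+1 = 0)%N ?mulr1 ?mul1r; [ring | lia].
case: eqVneq => [->|nkn]; first by rewrite (@qbin_small _ _ n.+1) // !mulr0; ring.
rewrite mul0r addr0; ring.
Qed.

Lemma qbin_add2_1 q n :
  qbin q n.+2 1 = (1 + q ^+ n.+1) * qbin q n 0 + q * qbin q n 1.
Proof. rewrite qbinS qbinS' !qbin0 subn0 (exprS q n); ring. Qed.

(** Equating the two Pascal rules expresses the difference as q^(k + 1) times the first coefficient
    minus q^(n - k) times the second. *)
Lemma qbin_diff q n k : (k < n)%N ->
  exists y, qbin q n k.+1 - qbin q n k = q ^+ minn k.+1 (n - k) * y.
Proof.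
move=> lt_kn; pose d := minn k.+1 (n - k).
exists (q ^+ (k.+1 - d) * qbin q n k.+1 - q ^+ (n - k - d) * qbin q n k).
rewrite mulrBr !mulrA -!exprD !subnKC ?geq_minl ?geq_minr //.
have := qbinS' q n k; rewrite qbinS.
move: (qbin q n k) (qbin q n k.+1) => a b E; apply/eqP; rewrite -subr_eq0.
rewrite (_ : _ - _ = q ^+ (n - k) * a + b - (a + q ^+ k.+1 * b)); last by ring.
by rewrite E subrr.
Qed.

(** Telescoping of [qbin_diff] between m - d and m + d, where the exponents are least at the two
    ends. *)
Lemma qbin_central q n m k d : (m + d <= n)%N -> (d <= m)%N ->
  (k <= m + d)%N -> (m <= k + d)%N ->
  exists y, qbin q n k - qbin q n m =
    q ^+ minn (m - d).+1 (n - (m + d)).+1 * y.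
Proof.
move=> le_mdn le_dm le_k le_m; set D := minn _ _.
have up j i : (m - d <= j)%N -> (j + i <= m + d)%N ->
    exists y, qbin q n (j + i) - qbin q n j = q ^+ D * y.
  move=> le_j; elim: i => [|i IHi] le_ji.
    by exists 0; rewrite addn0 subrr mulr0.
  have [|y Ey] := IHi; first lia.
  have [|z Ez] := @qbin_diff q n (j + i); first lia.
  set f := minn _ _ in Ez.
  exists (y + q ^+ (f - D) * z); rewrite mulrDr mulrA -exprD.
  rewrite (_ : D + (f - D) = f)%N; last by rewrite /D /f; lia.
  rewrite -Ey -Ez addnS; ring.
have [le_mk|lt_km] := leqP m k.
  have [| |y] := up m (k - m)%N; [lia | lia |].
  by rewrite subnKC // => E; exists y.
have [| |y] := up k (m - k)%N; [lia | lia |].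
rewrite subnKC ?(ltnW lt_km) // => E; exists (- y).
by rewrite mulrN -E opprB.
Qed.

End QBinomial.

Arguments qbin : simpl never.

Lemma rmorph_qbin (R S : comNzRingType) (f : {rmorphism R -> S}) q n k :
  qbin (f q) n k = f (qbin q n k).
Proof.
elim: n k => [|n IHn] [|k]; rewrite ?qbin0 ?rmorph1 //.
  by rewrite !qbin_small ?rmorph0.
by rewrite !qbinS rmorphD rmorphM rmorphXn !IHn.
Qed.

(* [g] has increments [g (n + 1) - g n = b n + r]: triangular numbers for
   [b = r = h = 1], squares for [b = 2], [r = 1], [h = 0]. *)
Section FiniteTripleProduct.
Variables (R : comNzRingType) (p c : R) (g : int -> nat) (b r h : nat).
Hypothesis gD1 : forall n : int, (g (n + 1))%:Z = (g n)%:Z + b%:Z * n + r%:Z.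
Hypothesis hE : (b * h.+1 = 2 * r)%N.

(** Induction on N: since c e(n) = e(n + 1) + e(n - 1), the factor 1 + c x + x^2 with x = p^(b N +
    r) acts on the coefficients by [qbin_add2]; [hE] gives x^2 the required exponent. *)
Lemma finite_triple_product (e : int -> R) (N : nat) :
  (forall n, e (n + 1) + e (n - 1) = c * e n) ->
  \prod_(1 <= j < N.+1) (1 + c * p ^+ (b * j.-1 + r) + p ^+ (b * j.-1 + r) ^+ 2) *
    (\sum_(k < h.+1) p ^+ g (k%:Z - h%:Z) * qbin (p ^+ b) h k * e (k%:Z - h%:Z)) =
  \sum_(k < (2 * N + h).+1)
    p ^+ g (k%:Z - (N + h)%:Z) * qbin (p ^+ b) (2 * N + h) k * e (k%:Z - (N + h)%:Z).
Proof.
move=> eD; elim: N => [|N IHN]; first by rewrite big_geq // mul1r.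
rewrite big_nat_recr //= mulrAC IHN; set x := p ^+ (b * N + r).
set M := (2 * N + h)%N; rewrite (_ : 2 * N.+1 + h = M.+2)%N; last by rewrite /M; lia.
pose w k := g (k%:Z - (N.+1 + h)%:Z); pose E k := e (k%:Z - (N.+1 + h)%:Z).
pose B k := qbin (p ^+ b) M k.
have xw2 k : x * p ^+ w k.+1 = p ^+ w k * (p ^+ b) ^+ k.
  rewrite /x /w -!exprM -!exprD; congr (_ ^+ _).
  have := gD1 (k%:Z - (N.+1 + h)%:Z).
  rewrite (_ : k%:Z - _ + 1 = k.+1%:Z - (N.+1 + h)%:Z); last by lia.
  by move: (g _) (g _); nia.
have xw0 k : (k <= M)%N -> x * p ^+ w k.+1 = p ^+ w k.+2 * (p ^+ b) ^+ (M - k).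
  move=> le_kM; rewrite /x /w -!exprM -!exprD; congr (_ ^+ _).
  have := gD1 (k.+1%:Z - (N.+1 + h)%:Z).
  rewrite (_ : k.+1%:Z - _ + 1 = k.+2%:Z - (N.+1 + h)%:Z); last by lia.
  by move: le_kM; rewrite /M; move: (g _) (g _); nia.
have xx : x ^+ 2 = (p ^+ b) ^+ M.+1.
  by rewrite /x -!exprM; congr (_ ^+ _); rewrite /M; nia.
have B0 k : (M < k)%N -> B k = 0 by exact: qbin_small.
(* The k-th old term sits at the new index k + 1; times the new factor, it splits into parts
   carrying [E k], [E k.+1] and [E k.+2]. *)
pose F0 k := p ^+ w k * (p ^+ b) ^+ k * B k * E k.
pose F1 k := (1 + x ^+ 2) * p ^+ w k.+1 * B k * E k.+1.
pose F2 k := p ^+ w k.+2 * (p ^+ b) ^+ (M - k) * B k * E k.+2.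
transitivity (\sum_(k < M.+1) (F0 k + F1 k + F2 k)).
  rewrite mulr_suml; apply: eq_bigr => -[k /= ltkM] _.
  rewrite /F0 /F1 /F2 -xw2 -xw0; last by lia.
  have := eD (k%:Z - (N + h)%:Z); rewrite /w /E.
  rewrite (_ : k%:Z - _ + 1 = k.+2%:Z - (N.+1 + h)%:Z); last by lia.
  rewrite (_ : k%:Z - _ - 1 = k%:Z - (N.+1 + h)%:Z); last by lia.
  rewrite (_ : k%:Z - (N + h)%:Z = k.+1%:Z - (N.+1 + h)%:Z); last by lia.
  move: (e _) (e _) (e _) (p ^+ g _) => e0 e2 e1 y ce.
  rewrite (_ : _ * (1 + _ + _) = (1 + x ^+ 2) * y * B k * e0 + x * y * B k * (c * e0)).
    by rewrite -ce; ring.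
  by rewrite /B; ring.
(* The sums are shifted so that the general term carries [E k.+2], those with [E 0] and [E 1] being
   set apart; the indices added at the top contribute 0 by [B0]. *)
rewrite !big_split /=.
have -> : \sum_(k < M.+1) F0 k = F0 0%N + (F0 1%N + \sum_(k < M.+1) F0 k.+2).
  have -> : \sum_(k < M.+1) F0 k = \sum_(k < M.+3) F0 k.
    by rewrite [RHS]big_ord_recr [X in _ = X + _]big_ord_recr /= /F0 !B0 ?leqnSn // !(mulr0, mul0r, addr0).
  by rewrite big_ord_recl; congr (_ + _); rewrite big_ord_recl.
have -> : \sum_(k < M.+1) F1 k = F1 0%N + \sum_(k < M.+1) F1 k.+1.
  have -> : \sum_(k < M.+1) F1 k = \sum_(k < M.+2) F1 k.
    by rewrite [RHS]big_ord_recr /= /F1 !B0 // !(mulr0, mul0r, addr0).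
  by rewrite [LHS]big_ord_recl.
rewrite [RHS]big_ord_recl [X in _ = _ + X]big_ord_recl /=.
rewrite (_ : F0 0%N + _ + _ + _ = F0 0%N + ((F0 1%N + F1 0%N) +
  \sum_(k < M.+1) (F0 k.+2 + F1 k.+1 + F2 k))); last by rewrite !big_split /=; ring.
congr (_ + (_ + _)).
- by rewrite /F0 /B !qbin0 !mulr1.
- rewrite /F0 /F1 /B /bump /= ?addn0 ?add1n qbin_add2_1 xx; rewrite /w /E; ring.
apply: eq_bigr => -[k /= ltkM] _; rewrite /F0 /F1 /F2 /B /bump /= ?add1n.
rewrite qbin_add2 // xx; rewrite /w /E; ring.
Qed.

Hypothesis b_gt0 : (0 < b)%N.
Hypothesis g_ge : forall n : int, (`|n| <= (g n).+1)%N.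

(** For |n| > N the power p^(g n) is divisible by p^N; otherwise the missing power is supplied by
    the difference between the q-binomial coefficient and the central one. *)
Lemma triple_product_mod (e : int -> R) (N : nat) :
  (forall n, e (n + 1) + e (n - 1) = c * e n) ->
  exists y,
  \prod_(1 <= j < N.+1) (1 + c * p ^+ (b * j.-1 + r) + p ^+ (b * j.-1 + r) ^+ 2) *
    (\sum_(k < h.+1) p ^+ g (k%:Z - h%:Z) * qbin (p ^+ b) h k * e (k%:Z - h%:Z)) =
  qbin (p ^+ b) (2 * N + h) (N + h) *
    (\sum_(k < (2 * N + h).+1) p ^+ g (k%:Z - (N + h)%:Z) * e (k%:Z - (N + h)%:Z))
  + p ^+ N * y.
Proof.
move=> eD; rewrite finite_triple_product //.
set M := (2 * N + h)%N; set beta := qbin _ M (N + h).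
have dvd k : exists z, (k <= M)%N ->
    p ^+ g (k%:Z - (N + h)%:Z) * (qbin (p ^+ b) M k - beta) = p ^+ N * z.
  set n := k%:Z - _; have := g_ge n; set G := g n => g_n.
  case: (leqP k M) => [le_kM | _]; last by exists 0.
  have [le_nN | lt_Nn] := leqP `|n| N; last first.
    exists (p ^+ (G - N) * (qbin (p ^+ b) M k - beta)) => _.
    by rewrite mulrA -exprD subnKC //; lia.
  have [||||z Ez] := @qbin_central _ (p ^+ b) M (N + h) k `|n|; rewrite /M; try lia.
  rewrite Ez -exprM; set f := minn _ _.
  (* Here G >= |n| - 1 and f >= N - |n| + 1. *)
  have le_f : (N <= G + b * f)%N.
    have : (N - `|n| < f)%N by rewrite /f; lia.
    by move: b_gt0; nia.
  exists (p ^+ (G + b * f - N) * z) => _.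
  by rewrite !mulrA -!exprD subnKC.
have [z Ez] := choice dvd.
exists (\sum_(k < M.+1) z k * e (k%:Z - (N + h)%:Z)).
rewrite !mulr_sumr -big_split /=; apply: eq_bigr => -[k /= ltkM] _.
by rewrite !mulrA -Ez //; ring.
Qed.

End FiniteTripleProduct.

(** * Infinite sums of power series *)

Section FpsSum.
Variable R : comNzRingType.

Lemma fps_summableP (I : choiceType) (F : I -> {fps R}) :
  fps_summable F <->
  forall m, exists A : {fset I}, forall i, i \notin A -> F i m = 0.
Proof.
split=> [F_fin m | F_fin m]; last first.
  have [A FA] := F_fin m; apply: (finite_subfset A) => i /= Fi.
  by apply: contraNT Fi => /FA ->.
have /finite_fsetP[A EA] := F_fin m; exists A => i; apply: contraNeq => Fi.
by have : [set i | F i m != 0]%classic i by []; rewrite EA.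
Qed.

(** A single finite set serves all degrees up to m, which is what the coefficient of degree m of a
    product involves. *)
Lemma fps_summable_le (I : choiceType) (F : I -> {fps R}) m :
  fps_summable F ->
  exists A : {fset I}, forall i, i \notin A ->
    forall k, (k <= m)%N -> F i k = 0.
Proof.
move=> /fps_summableP /choice[A FA].
exists (\bigcup_(k <- iota 0 m.+1) A k)%fset => i iA k le_km; apply: FA.
apply: contra iA => iAk; apply/bigfcupP; exists k => //.
by rewrite mem_iota andbT.
Qed.

Lemma fps_summableM (I : choiceType) (y : {fps R}) (F : I -> {fps R}) :
  fps_summable F -> fps_summable (fun i => y * F i).
Proof.
move=> F_fin; apply/fps_summableP => m; have [A FA] := fps_summable_le m F_fin.
exists A => i iA; rewrite fpsME big1 // => j _.
by rewrite FA ?mulr0 ?leq_subr.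
Qed.

Lemma fps_sumM (I : choiceType) (y : {fps R}) (F : I -> {fps R}) :
  fps_summable F -> y * fps_sum F = fps_sum (fun i => y * F i).
Proof.
move=> F_fin; apply: fpsP => m; have [A FA] := fps_summable_le m F_fin.
rewrite fpsME (fps_sum_coef (A := A)); last first.
  move=> i iA; rewrite fpsME big1 // => j _.
  by rewrite FA ?mulr0 ?leq_subr.
under [RHS]eq_bigr do rewrite fpsME.
rewrite exchange_big; apply: eq_bigr => j _.
rewrite -mulr_sumr (fps_sum_coef (A := A)) // => i iA.
by rewrite FA ?leq_subr.
Qed.

Lemma fps_sum_big (I : choiceType) n (F : 'I_n -> I -> {fps R}) :
  (forall k, fps_summable (F k)) ->
  fps_sum (fun i => \sum_(k < n) F k i) = \sum_(k < n) fps_sum (F k).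
Proof.
move=> F_fin; apply: fpsP => m.
have /choice[A FA] k : exists A : {fset I}, forall i, i \notin A -> F k i m = 0.
  by have /fps_summableP := F_fin k.
pose B := (\bigcup_(k <- enum 'I_n) A k)%fset.
have FB k i : i \notin B -> F k i m = 0.
  move=> iB; apply: FA; apply: contra iB => iA; apply/bigfcupP.
  by exists k; rewrite ?mem_enum.
rewrite fps_bigE (fps_sum_coef (A := B)) => [|i iB]; last first.
  by rewrite fps_bigE big1 // => k _; exact: FB.
under eq_bigr do rewrite fps_bigE.
rewrite exchange_big; apply: eq_bigr => k _.
by rewrite (fps_sum_coef (A := B)) // => i /FB.
Qed.

Lemma fps_summableD (I : choiceType) (F G : I -> {fps R}) :
  fps_summable F -> fps_summable G -> fps_summable (fun i => F i + G i).
Proof.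
move=> /fps_summableP F_fin /fps_summableP G_fin; apply/fps_summableP => m.
have [A FA] := F_fin m; have [B GB] := G_fin m; exists (A `|` B)%fset => i.
by rewrite inE negb_or => /andP[/FA Fi /GB Gi]; rewrite fpsDE Fi Gi addr0.
Qed.

Lemma fps_sumD (I : choiceType) (F G : I -> {fps R}) :
  fps_summable F -> fps_summable G ->
  fps_sum (fun i => F i + G i) = fps_sum F + fps_sum G.
Proof.
move=> F_fin G_fin; pose H (k : 'I_2) i := if k == 0 then F i else G i.
have H_fin k : fps_summable (H k) by rewrite /H; case: (k == 0).
have := fps_sum_big H_fin; rewrite big_ord_recl big_ord1 /= => <-.
by congr fps_sum; apply: funext => i; rewrite big_ord_recl big_ord1.
Qed.

Lemma eq_fps_sum (I : choiceType) (F G : I -> {fps R}) :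
  F =1 G -> fps_sum F = fps_sum G.
Proof. by move=> /funext ->. Qed.

Lemma fps_sum0 (I : choiceType) : fps_sum (fun _ : I => 0 : {fps R}) = 0.
Proof. by apply: fpsP => m; rewrite (fps_sum_coef (A := (fset0 : {fset I}))) ?big_seq_fset0. Qed.

Lemma fps_sum_reindex (I J : choiceType) (h : I -> J) (F : J -> {fps R}) :
  bijective h -> fps_sum F = fps_sum (fun i => F (h i)).
Proof. by move=> bij_h; apply: fpsP => m; apply: reindex_fsbigT. Qed.

Lemma fps_sum_range (I J : choiceType) (h : I -> J) (F : J -> {fps R}) :
  injective h -> (forall j, (forall i, j <> h i) -> F j = 0) ->
  fps_sum F = fps_sum (fun i => F (h i)).
Proof.
move=> inj_h F0; apply: fpsP => m /=.
rewrite -(fsbig_image setT h (fun j => F j m)); last by move=> x y _ _ /inj_h.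
apply/esym/fsbig_widen => // j [_ /= hj]; rewrite F0 // => i ji.
by apply: hj; exists i.
Qed.

Lemma fps_sum_exchange (I J : choiceType) (F : I -> J -> {fps R}) :
  (forall m, exists (A : {fset I}) (B : {fset J}),
    forall i j, (i \notin A) || (j \notin B) -> F i j m = 0) ->
  fps_sum (fun i => fps_sum (F i)) = fps_sum (fun j => fps_sum (fun i => F i j)).
Proof.
move=> F_fin; apply: fpsP => m; have [A [B FAB]] := F_fin m.
have EB i : fps_sum (F i) m = \sum_(j <- B) F i j m.
  by apply: fps_sum_coef => j jB; rewrite FAB // jB orbT.
have EA j : fps_sum (fun i => F i j) m = \sum_(i <- A) F i j m.
  by apply: fps_sum_coef => i iA; rewrite FAB // iA.
rewrite (fps_sum_coef (A := A)) => [|i iA]; last first.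
  by rewrite EB big1 // => j _; rewrite FAB // iA.
rewrite [RHS](fps_sum_coef (A := B)) => [|j jB]; last first.
  by rewrite EA big1 // => i _; rewrite FAB // jB orbT.
under eq_bigr do rewrite EB; under [RHS]eq_bigr do rewrite EA.
exact: exchange_big.
Qed.

End FpsSum.

(** * Sums converging q-adically *)

Section QSum.
Variable R : comNzRingType.
Local Notation K := {fps {fps R}}.
Let q : K := fpsC fpsX.

(** Divisibility by q^n, expressed on coefficients so that no cofactor has to be carried along. *)
Definition qdvd n (x : K) := forall m d, (d < n)%N -> x m d = 0.

Lemma qdvd_qXn n (y : K) : qdvd n (q ^+ n * y).
Proof.
move=> m d lt_dn; rewrite /q -rmorphXn fpsCME.
exact: (fps_lowM _ (fps_lowX (n := n) _)).
Qed.

Lemma qdvdM n (x y : K) : qdvd n x -> qdvd n (y * x).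
Proof.
move=> x0 m d lt_dn; rewrite fpsME fps_bigE big1 // => j _.
by rewrite mulrC; apply: fps_lowM lt_dn => i; apply: x0.
Qed.

Lemma qdvdD n (x y : K) : qdvd n x -> qdvd n y -> qdvd n (x + y).
Proof. by move=> x0 y0 m d lt_dn; rewrite !fpsDE x0 // y0 // addr0. Qed.

Lemma qdvdB n (x y : K) : qdvd n x -> qdvd n y -> qdvd n (x - y).
Proof. by move=> x0 y0 m d lt_dn; rewrite !fpsBE x0 // y0 // subr0. Qed.

Definition qsummable (I : choiceType) (F : I -> K) :=
  forall m, fps_summable (fun i => F i m).

(* The sums converge for the q-adic topology only, hence not as series in X:
   they are taken in each coefficient of X^m. *)
Definition qsum (I : choiceType) (F : I -> K) : K :=
  \fps_(m) fps_sum (fun i => F i m).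

Lemma qsumE (I : choiceType) (F : I -> K) m :
  qsum F m = fps_sum (fun i => F i m).
Proof. by []. Qed.

Lemma qsummable_exp (I : choiceType) (g : I -> nat) (y : I -> K) :
  (forall d, exists A : {fset I}, forall i, i \notin A -> (d < g i)%N) ->
  qsummable (fun i => q ^+ g i * y i).
Proof.
move=> g_fin m; apply/fps_summableP => d; have [A gA] := g_fin d.
by exists A => i /gA; apply: qdvd_qXn.
Qed.

Lemma qsummableM (I : choiceType) (y : K) (F : I -> K) :
  qsummable F -> qsummable (fun i => y * F i).
Proof.
move=> F_fin m; apply/fps_summableP => d.
have /choice[A FA] (k : nat) : exists A : {fset I},
    forall i, i \notin A -> forall l, (l <= d)%N -> F i k l = 0.
  exact: fps_summable_le (F_fin k).
exists (\bigcup_(k <- iota 0 m.+1) A k)%fset => i iA.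
rewrite fpsME fps_bigE big1 // => j _; rewrite fpsME big1 // => l _.
rewrite FA ?mulr0 ?leq_subr //; apply: contra iA => iA.
by apply/bigfcupP; exists (m - j)%N; rewrite // mem_iota ltnS leq_subr.
Qed.

Lemma qsumM (I : choiceType) (y : K) (F : I -> K) :
  qsummable F -> y * qsum F = qsum (fun i => y * F i).
Proof.
move=> F_fin; apply: fpsP => m; rewrite qsumE fpsME.
rewrite (eq_fps_sum (G := fun i => \sum_(j < m.+1) y j * F i (m - j)%N)) //.
rewrite fps_sum_big => [|j]; last exact/fps_summableM/F_fin.
by apply: eq_bigr => j _; rewrite qsumE fps_sumM //; exact: F_fin.
Qed.

Lemma qsumD (I : choiceType) (F G : I -> K) :
  qsummable F -> qsummable G ->
  qsum (fun i => F i + G i) = qsum F + qsum G.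
Proof.
move=> F_fin G_fin; apply: fpsP => m; rewrite fpsDE !qsumE.
by rewrite -fps_sumD.
Qed.

Lemma eq_qsum (I : choiceType) (F G : I -> K) : F =1 G -> qsum F = qsum G.
Proof. by move=> /funext ->. Qed.

Lemma qsum_reindex (I J : choiceType) (h : I -> J) (F : J -> K) :
  bijective h -> qsum F = qsum (fun i => F (h i)).
Proof. by move=> bij_h; apply: fpsP => m; apply: fps_sum_reindex. Qed.

Lemma qsum_range (I J : choiceType) (h : I -> J) (F : J -> K) :
  injective h -> (forall j, (forall i, j <> h i) -> F j = 0) ->
  qsum F = qsum (fun i => F (h i)).
Proof.
move=> inj_h F0; apply: fpsP => m; apply: fps_sum_range => // j /F0 ->.
exact: fps0E.
Qed.

Lemma qsum_exchange (I J : choiceType) (F : I -> J -> K) :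
  (forall d, exists (A : {fset I}) (B : {fset J}),
    forall i j, (i \notin A) || (j \notin B) -> qdvd d (F i j)) ->
  qsum (fun i => qsum (F i)) = qsum (fun j => qsum (fun i => F i j)).
Proof.
move=> F_fin; apply: fpsP => m; apply: fps_sum_exchange => d.
have [A [B FAB]] := F_fin d.+1; exists A, B => i j /FAB; exact.
Qed.

Lemma int_ball (d : nat) : exists A : {fset int},
  forall i, i \notin A -> (d < `|i|)%N.
Proof.
pose s := [seq k%:Z - d%:Z | k <- iota 0 (2 * d).+1].
exists [fset x in s]%fset => i; rewrite in_fset ltnNge.
apply: contra => le_id; apply/mapP.
by exists (absz (i + d%:Z)); rewrite ?mem_iota; lia.
Qed.

(** A linear lower bound on the exponents leaves finitely many terms in each degree; C absorbs
    shifts such as that of [tri (l - 2 * n)]. *)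
Lemma qsummable_int C (g : int -> nat) (y : int -> K) :
  (forall i, (`|i| <= C * (g i).+1)%N) -> qsummable (fun i => q ^+ g i * y i).
Proof.
move=> g_ge; apply: qsummable_exp => d; have [A dA] := int_ball (C * d.+1).
exists A => i /dA lt_i; have := leq_trans lt_i (g_ge i).
by rewrite ltn_mul2l ltnS => /andP[].
Qed.

Lemma qsum_int (F : int -> K) : qsummable F ->
  qsum F = qsum (fun n : nat => F n%:Z) + qsum (fun n : nat => F (- n.+1%:Z)).
Proof.
move=> F_fin; pose P (i : int) := 0 <= i.
have fin (Q : pred int) : qsummable (fun i => if Q i then F i else 0).
  move=> m; apply/fps_summableP => d; have /fps_summableP/(_ d)[A FA] := F_fin m.
  by exists A => i /FA Fi; case: ifP => // _; rewrite fps0E.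
rewrite (@eq_qsum _ F (fun i => (if P i then F i else 0) + (if ~~ P i then F i else 0))).
  rewrite qsumD //; congr (_ + _).
    rewrite (@qsum_range _ _ Posz) => [|m n []//|j Pj]; first exact: eq_qsum.
    by rewrite /P; case: ifP => // j0; have := Pj `|j|%N; lia.
  rewrite (@qsum_range _ _ Negz) => [|m n []//|j Pj].
    by apply: eq_qsum => n; rewrite /= NegzE.
  by rewrite /P; case: ifP => // j0; have := Pj (`|j|.-1)%N; rewrite NegzE; lia.
by move=> i; case: (P i); rewrite ?addr0 ?add0r.
Qed.

Lemma qsum_mod3 (F : int -> K) : qsummable F ->
  qsum F = qsum (fun n : int => F (3 * n)) + qsum (fun n : int => F (3 * n - 1))
    + qsum (fun n : int => F (3 * n + 1)).
Proof.
move=> F_fin; pose G a (i : int) := if (3 %| i + a)%Z then F i else 0.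
have fin a : qsummable (G a).
  move=> m; apply/fps_summableP => d; have /fps_summableP/(_ d)[A FA] := F_fin m.
  by exists A => i /FA Fi; rewrite /G; case: ifP => // _; rewrite fps0E.
have shift a : qsum (G a) = qsum (fun n : int => F (3 * n - a)).
  rewrite (@qsum_range _ _ (fun n : int => 3 * n - a)) => [|m n /=|j Pj].
  - by apply: eq_qsum => n; rewrite /G ifT //; lia.
  - lia.
  - by rewrite /G; case: ifP => // j0; have := Pj ((j + a) %/ 3)%Z; lia.
rewrite (@eq_qsum _ F (fun i => G 0 i + (G 1 i + G (- 1) i))); last first.
  move=> i; rewrite /G; case: ifP; case: ifP; case: ifP; rewrite ?addr0 ?add0r //; lia.
rewrite qsumD ?qsumD //; last first.
  move=> m; apply: fps_summableD; exact: fin.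
rewrite !shift addrA; congr (_ + _ + _); apply: eq_qsum => n; congr F; lia.
Qed.

(** An index i outside the window from -(N + h) to N has |i| > N, hence g i >= N. *)
Lemma qsum_window (g : int -> nat) (y : int -> K) (N h : nat) :
  (forall i, (`|i| <= (g i).+1)%N) ->
  qdvd N (qsum (fun i => q ^+ g i * y i) -
    \sum_(k < (2 * N + h).+1)
      q ^+ g (k%:Z - (N + h)%:Z) * y (k%:Z - (N + h)%:Z)).
Proof.
move=> g_ge m d lt_dN; rewrite !fpsBE qsumE !fps_bigE.
pose r := [seq k%:Z - (N + h)%:Z | k <- iota 0 (2 * N + h).+1].
rewrite [X in X - _](_ : _ = \sum_(i <- r) (q ^+ g i * y i) m d); last first.
  rewrite (@bigfs _ _ _ _ r xpredT) ?set_true //.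
    by rewrite map_inj_uniq ?iota_uniq // => i j; lia.
  move=> i _ ir; apply: (@qdvd_qXn (g i)).
  rewrite ltnNge; apply: contra ir => le_gd; have := g_ge i => g_gei.
  by apply/mapP; exists (absz (i + (N + h)%:Z)); rewrite ?mem_iota; lia.
rewrite /r big_map (_ : iota 0 _ = index_iota 0 (2 * N + h).+1) ?big_mkord ?subrr //.
Qed.

End QSum.

(** * Sines and cosines of multiples of X *)

(* [cos_sgn m] and [sin_sgn m] are the real and imaginary parts of i^m. *)
Definition cos_sgn (m : nat) : rat := if odd m then 0 else (-1) ^+ m./2.
Definition sin_sgn (m : nat) : rat := if odd m then (-1) ^+ m./2 else 0.

(** [cosz k] and [sinz k] are cos(kX) and sin(kX), given by their coefficients; the common form lets
    one product formula serve both. *)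
Definition trigz (s : nat -> rat) (k : int) : {fps {fps rat}} :=
  \fps_(m) fpsC (s m * (k%:~R ^+ m / m`!%:R)).

Notation cosz := (trigz cos_sgn).
Notation sinz := (trigz sin_sgn).

Section Trigonometry.
Local Notation K := {fps {fps rat}}.
Let X : K := fpsX.

Lemma trigzE s k m : trigz s k m = fpsC (s m * (k%:~R ^+ m / m`!%:R)).
Proof. by []. Qed.

Lemma trigzM s s' k l m :
  (trigz s k * trigz s' l) m =
  fpsC (\sum_(j < m.+1) s j * s' (m - j)%N *
    ((k%:~R ^+ j / j`!%:R) * (l%:~R ^+ (m - j) / (m - j)`!%:R))).
Proof.
rewrite fpsME rmorph_sum; apply: eq_bigr => j _.
by rewrite !trigzE -rmorphM /=; congr fpsC; ring.
Qed.

Lemma divided_powerD (x y : rat) m :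
  (x + y) ^+ m / m`!%:R =
  \sum_(j < m.+1) (x ^+ j / j`!%:R) * (y ^+ (m - j) / (m - j)`!%:R).
Proof.
rewrite addrC exprDn mulr_suml; apply: eq_bigr => -[j /= le_jm] _.
have nz n : n`!%:R != 0 :> rat by rewrite pnatr_eq0 -lt0n fact_gt0.
rewrite -(bin_fact (ltnSE le_jm)) -mulr_natr !natrM.
have nzC : 'C(m, j)%:R != 0 :> rat by rewrite pnatr_eq0 -lt0n bin_gt0.
have := nz j; have := nz (m - j)%N; move: nzC => *; field.
by apply/and3P.
Qed.

(** Real and imaginary parts of i^(j + l) = i^j i^l, paired so as to rewrite with either
    equation. *)
Lemma sgnM j l :
  (cos_sgn (j + l) = cos_sgn j * cos_sgn l - sin_sgn j * sin_sgn l) *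
  (sin_sgn (j + l) = sin_sgn j * cos_sgn l + cos_sgn j * sin_sgn l).
Proof.
rewrite /cos_sgn /sin_sgn oddD halfD.
by case: (odd j); case: (odd l); rewrite /= ?add0n ?add1n ?exprS ?exprD;
  split; ring.
Qed.

Lemma coszD k l : cosz (k + l) = cosz k * cosz l - sinz k * sinz l.
Proof.
apply: fpsP => m; rewrite fpsBE !trigzM trigzE -rmorphB /= -sumrB intrD.
congr fpsC; rewrite divided_powerD mulr_sumr; apply: eq_bigr => -[j /= le_jm] _.
by rewrite -mulrBl -sgnM subnKC.
Qed.

Lemma sinzD k l : sinz (k + l) = sinz k * cosz l + cosz k * sinz l.
Proof.
apply: fpsP => m; rewrite fpsDE !trigzM trigzE -rmorphD /= -big_split intrD.
congr fpsC; rewrite divided_powerD mulr_sumr; apply: eq_bigr => -[j /= le_jm] _.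
by rewrite /= -mulrDl -sgnM subnKC.
Qed.

Lemma coszN k : cosz (- k) = cosz k.
Proof.
apply: fpsP => m; rewrite !trigzE /cos_sgn; case: ifP => m_odd; first by rewrite !mul0r.
by rewrite mulrNz (exprNn k%:~R) -(signr_odd _ m) m_odd mul1r.
Qed.

Lemma sinzN k : sinz (- k) = - sinz k.
Proof.
apply: fpsP => m; rewrite fpsNE !trigzE -rmorphN /sin_sgn; case: ifP => m_odd.
  by rewrite mulrNz (exprNn k%:~R) -(signr_odd _ m) m_odd /=; congr fpsC; ring.
by rewrite !mul0r oppr0.
Qed.

Lemma cosz0 : cosz 0 = 1.
Proof.
apply: fpsP => -[|m]; rewrite trigzE fps1E /=.
  by rewrite /cos_sgn /= !mul1r invr1.
by rewrite exprS !mul0r mulr0 rmorph0.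
Qed.

Lemma coszDB k l : cosz (k + l) + cosz (k - l) = 2 * cosz l * cosz k.
Proof. rewrite !coszD coszN sinzN; ring. Qed.

Lemma sinzDB k l : sinz (k + l) + sinz (k - l) = 2 * cosz l * sinz k.
Proof. rewrite !sinzD coszN sinzN; ring. Qed.

(** Brings the factors of the theorem to triple product form: (1 - x)^2 + 4 sin^2(kX) x = 1 - 2
    cos(2kX) x + x^2. *)
Lemma sinz_sqr k : 4 * sinz k ^+ 2 = 2 - 2 * cosz (2 * k).
Proof.
rewrite (_ : 2 * k = k + k); last by ring.
have E : cosz k * cosz k + sinz k * sinz k = 1.
  by rewrite -cosz0 -(subrr k) coszD coszN sinzN; ring.
rewrite coszD; move: (cosz k) (sinz k) E => c s E.
rewrite (_ : 4 * s ^+ 2 = 2 * (c * c + s * s) - 2 * (c * c - s * s)); last by ring.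
by rewrite E mulr1.
Qed.

Lemma fps2_natV n : (n.+1%:R : K)^-1 = fpsC (fpsC n.+1%:R^-1).
Proof.
have nz : n.+1%:R \is a @GRing.unit rat by rewrite unitfE pnatr_eq0.
by rewrite !rmorphV ?rmorph_nat // fps_unitE fps_natE.
Qed.

Lemma trig_termE (a : {fps rat}) t M :
  (-1) ^+ t * fpsC a * (X ^+ M / (M`!)%:R) =
  fpsC ((-1) ^+ t * a * fpsC (M`!%:R)^-1) * X ^+ M.
Proof.
have := fact_gt0 M; case: M`! => // n _.
rewrite fps2_natV !rmorphM rmorphXn rmorphN1; ring.
Qed.

Lemma trig_term_int (k : int) t M :
  (-1) ^+ t * ((k%:~R * X) ^+ M / (M`!)%:R) =
  fpsC ((-1) ^+ t * k%:~R ^+ M * fpsC (M`!%:R)^-1) * X ^+ M.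
Proof. by rewrite -trig_termE exprMn rmorphXn /= rmorph_int; ring. Qed.

Lemma fps_sum_odd (f : nat -> {fps rat}) :
  fps_sum (fun t => fpsC (f t) * X ^+ (2 * t + 1)) =
  \fps_(m) (if odd m then f m./2 else 0).
Proof.
apply: fpsP => m.
have E t : (fpsC (f t) * X ^+ (2 * t + 1)) m = if m == (2 * t + 1)%N then f t else 0.
  by rewrite fpsCME fpsXnE; case: eqP; rewrite ?mulr1 ?mulr0.
rewrite (fps_sum_coef (A := [fset m./2]%fset)) => [|t]; last first.
  rewrite inE E => tm; rewrite ifN //; lia.
rewrite big_seq_fset1 E /=; case: ifP; case: ifP => //; lia.
Qed.

Lemma fps_sum_even (f : nat -> {fps rat}) :
  fps_sum (fun t => fpsC (f t) * X ^+ (2 * t)) =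
  \fps_(m) (if odd m then 0 else f m./2).
Proof.
apply: fpsP => m.
have E t : (fpsC (f t) * X ^+ (2 * t)) m = if m == (2 * t)%N then f t else 0.
  by rewrite fpsCME fpsXnE; case: eqP; rewrite ?mulr1 ?mulr0.
rewrite (fps_sum_coef (A := [fset m./2]%fset)) => [|t]; last first.
  rewrite inE E => tm; rewrite ifN //; lia.
rewrite big_seq_fset1 E /=; case: ifP; case: ifP => //; lia.
Qed.

Lemma fps_sin_int (k : int) : fps_sin (k%:~R * X) = sinz k.
Proof.
rewrite /fps_sin.
rewrite (eq_fps_sum (fun t => trig_term_int k t _)) fps_sum_odd; apply: fpsP => m; rewrite trigzE /sin_sgn /=.
case: ifP => m_odd; last by rewrite mul0r rmorph0.
rewrite (_ : (2 * m./2 + 1)%N = m); last by lia.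
rewrite !rmorphM !rmorphXn /= rmorph_int rmorphN1; ring.
Qed.

Lemma fps_cos_int (k : int) : fps_cos (k%:~R * X) = cosz k.
Proof.
rewrite /fps_cos.
rewrite (eq_fps_sum (fun t => trig_term_int k t _)) fps_sum_even; apply: fpsP => m; rewrite trigzE /cos_sgn /=.
case: ifP => m_odd; first by rewrite mul0r rmorph0.
rewrite (_ : (2 * m./2)%N = m); last by lia.
rewrite !rmorphM !rmorphXn /= rmorph_int rmorphN1; ring.
Qed.

End Trigonometry.

(** * Theta series *)


Definition tri (n : int) : nat := `|(n * (n + 1) %/ 2)%Z|%N.
Definition pent (n : int) : nat := `|(n * (3 * n + 1) %/ 2)%Z|%N.
Definition sq (n : int) : nat := absz (n * n).

(** Doubling removes both the division and the absolute value, so that identities between exponents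
    become polynomial ones. *)
Lemma triE n : 2 * (tri n)%:Z = n * (n + 1).
Proof.
have dvd : (2 %| n * (n + 1))%Z.
  have [k [-> | ->]] : exists k, n = 2 * k \/ n = 2 * k + 1.
    by exists (n %/ 2)%Z; lia.
  - by rewrite -mulrA dvdz_mulr.
  - by rewrite (_ : _ * _ = 2 * ((2 * k + 1) * (k + 1))) ?dvdz_mulr //; ring.
have ge0 : 0 <= n * (n + 1).
  have [n_ge0 | n_le0] : 0 <= n \/ n <= - 1 by lia.
    by apply: mulr_ge0; lia.
  by apply: mulr_le0; lia.
rewrite /tri; lia.
Qed.

Lemma pentE n : 2 * (pent n)%:Z = n * (3 * n + 1).
Proof.
have dvd : (2 %| n * (3 * n + 1))%Z.
  have := triE n; have -> : n * (3 * n + 1) = 3 * (n * (n + 1)) - 2 * n by ring.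
  lia.
have ge0 : 0 <= n * (3 * n + 1).
  have [n_ge0 | n_le0] : 0 <= n \/ n <= - 1 by lia.
    by apply: mulr_ge0; lia.
  by apply: mulr_le0; lia.
rewrite /pent; lia.
Qed.

Lemma sqE n : (sq n)%:Z = n * n.
Proof. by rewrite /sq gez0_abs // -expr2 sqr_ge0. Qed.

(** The successor accounts for negative n: [tri] is 0 at -1 and 1 at -2. *)
Lemma tri_ge n : (`|n| <= (tri n).+1)%N. Proof. have := triE n; nia. Qed.
Lemma pent_ge n : (`|n| <= pent n)%N. Proof. have := pentE n; nia. Qed.
Lemma sq_ge n : (`|n| <= sq n)%N. Proof. have := sqE n; nia. Qed.

Lemma tri_nat (n : nat) : tri n%:Z = (n * (n + 1) %/ 2)%N.
Proof. have := triE n; lia. Qed.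

Section Sign.
Variable R : pzRingType.
Definition epsz (n : int) : R := (-1) ^+ `|n|%N.

Lemma epszD m n : epsz (m + n) = epsz m * epsz n.
Proof.
rewrite /epsz -exprD -signr_odd -[RHS]signr_odd; congr (_ ^+ nat_of_bool _); lia.
Qed.

Lemma epszN n : epsz (- n) = epsz n.
Proof. by rewrite /epsz abszN. Qed.

Lemma epszM n : epsz n * epsz n = 1.
Proof. by rewrite -epszD /epsz -signr_odd; rewrite (_ : odd _ = false) //; lia. Qed.

Lemma epsz1 : epsz 1 = -1. Proof. by []. Qed.
End Sign.

Lemma rmorph_epsz (R S : pzRingType) (f : {rmorphism R -> S}) n :
  f (epsz R n) = epsz S n.
Proof. by rewrite /epsz rmorphXn rmorphN1. Qed.

(** * Congruences modulo powers of q and passage to the limit *)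

Section QLimits.
Local Notation K := {fps {fps rat}}.
Let q : K := fpsC fpsX.

Lemma qdvd_unit n (u x : K) : u \is a GRing.unit -> qdvd n (u * x) -> qdvd n x.
Proof. by move=> u_unit /(qdvdM u^-1); rewrite mulKr. Qed.

Lemma qdvd_coef n (x : K) k : qdvd n x -> qdvd n (fpsC (x k)).
Proof. by move=> x0 [|m] d lt_dn; rewrite /= ?x0 ?fps0E. Qed.

Lemma qdvd_qsum (I : choiceType) n (F : I -> K) :
  (forall i, qdvd n (F i)) -> qdvd n (qsum F).
Proof.
move=> F0 m d lt_dn; rewrite qsumE (fps_sum_coef (A := (fset0 : {fset I}))).
  by rewrite big_seq_fset0.
by move=> i _; apply: F0.
Qed.

Lemma fps2_cvg_to_le (u : nat -> K) l m n : fps2_cvg_to u l ->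
  exists N, forall k, (N <= k)%N ->
    forall i j, (i <= m)%N -> (j <= n)%N -> u k i j = l i j.
Proof.
move=> ul; have /choice[N uN] (ij : nat * nat) : exists N, forall k,
    (N <= k)%N -> u k ij.1 ij.2 = l ij.1 ij.2 by exact: ul.
exists (\max_(i < m.+1) \max_(j < n.+1) N (nat_of_ord i, nat_of_ord j)).
move=> k le_k i j le_i le_j; apply: (uN (i, j)); apply: leq_trans le_k.
rewrite -ltnS in le_i; rewrite -ltnS in le_j.
apply: leq_trans (leq_bigmax (Ordinal le_i)).
exact: (leq_bigmax (F := fun j' : 'I_n.+1 => N (i, nat_of_ord j')) (Ordinal le_j)).
Qed.

(** A given coefficient of y u_N involves finitely many coefficients of u_N; for large N these are
    those of l, and the congruence modulo q^N reaches the degree considered. *)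
Lemma fps2_cvg_to_unique (u : nat -> K) l y a : fps2_cvg_to u l ->
  (forall N, qdvd N (y * u N - a)) -> y * l = a.
Proof.
move=> ul ua; apply: fpsP => m; apply: fpsP => d.
have [N uN] := fps2_cvg_to_le m d ul.
have := ua (maxn N d.+1) m d; rewrite leq_max ltnSn orbT => /(_ isT).
rewrite !fpsBE => /eqP; rewrite subr_eq0 => /eqP <-.
rewrite !fpsME !fps_bigE; apply: eq_bigr => i _; rewrite !fpsME.
by apply: eq_bigr => j _; rewrite uN ?leq_maxl ?leq_subr.
Qed.

(** [triple_product_mod] with the window completed to the whole series; beta is the central
    q-binomial coefficient, which lies in Q[[q]] by [rmorph_qbin]. *)
Lemma qsum_triple_product b r h (c : K) (g : int -> nat) (e : int -> K) N :
  (forall n : int, (g (n + 1))%:Z = (g n)%:Z + b%:Z * n + r%:Z) ->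
  (b * h.+1 = 2 * r)%N -> (0 < b)%N -> (forall n, `|n| <= (g n).+1)%N ->
  (forall n, e (n + 1) + e (n - 1) = c * e n) ->
  exists beta, qdvd N
  (\prod_(1 <= j < N.+1) (1 + c * q ^+ (b * j.-1 + r) + q ^+ (b * j.-1 + r) ^+ 2) *
    (\sum_(k < h.+1) q ^+ g (k%:Z - h%:Z) * qbin (q ^+ b) h k * e (k%:Z - h%:Z))
  - fpsC beta * qsum (fun n => q ^+ g n * e n)).
Proof.
move=> gD1 hE b_gt0 g_ge eD.
have [y ->] := triple_product_mod q gD1 hE b_gt0 g_ge N eD.
rewrite {3}/q -rmorphXn /= rmorph_qbin; set beta := qbin _ _ _; exists beta.
rewrite addrAC -mulrBr; apply: qdvdD; last exact: qdvd_qXn.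
rewrite -opprB mulrN -[- _]add0r; apply: qdvdB; first by [].
exact/qdvdM/qsum_window.
Qed.

End QLimits.

Lemma addn_eq_double (a b c d : nat) :
  2 * a%:Z + 2 * b%:Z = 2 * c%:Z + 2 * d%:Z -> (a + b = c + d)%N.
Proof. lia. Qed.

(** * The quintuple product identity, up to a factor free of X *)

Section QuintupleProduct.
Local Notation K := {fps {fps rat}}.
Let q : K := fpsC fpsX.

Definition pent2 (n : int) : nat := absz (n * (3 * n + 1)).

Lemma pent2E n : (pent2 n)%:Z = n * (3 * n + 1).
Proof. by rewrite -pentE /pent2 -pentE; lia. Qed.

Lemma pent2_ge n : (`|n| <= pent2 n)%N.
Proof. have := pent2E n; have := pentE n; have := pent_ge n; lia. Qed.

Lemma bij_opp : bijective (fun n : int => - n).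
Proof. by exists (fun n => - n) => n; rewrite opprK. Qed.

Lemma bij_add (a : int) : bijective (fun n : int => n + a).
Proof. by exists (fun n => n - a) => n; rewrite ?addrK ?subrK. Qed.

Lemma bij_refl (a : int) : bijective (fun n : int => a - n).
Proof. by exists (fun n => a - n) => n; rewrite opprB addrC subrK. Qed.

Lemma eq_opp_0 (x : K) : x = - x -> x = 0.
Proof.
move=> xN; apply: (mulrI (fps2_nat_unit 1)); rewrite mulr0.
by rewrite mulr_natl mulr2n {2}xN subrr.
Qed.

(** The reflection n -> -1 - n fixes the exponent and negates 2n + 1. *)
Lemma qsum_sin_tri0 : qsum (fun n : int => q ^+ tri n * sinz (2 * n + 1)) = 0.
Proof.
apply: eq_opp_0; rewrite [LHS](qsum_reindex _ (bij_refl (- 1))).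
rewrite -[RHS]mulN1r qsumM; last first.
  by apply: (qsummable_int (C := 1)) => n; rewrite mul1n tri_ge.
apply: eq_qsum => n; have -> : tri (- 1 - n) = tri n.
  by have := triE n; have := triE (- 1 - n); nia.
rewrite (_ : 2 * (- 1 - n) + 1 = - (2 * n + 1)); last by ring.
by rewrite sinzN; ring.
Qed.

(** Subtracting sin(4nX) times the vanishing sine series completes cos(4nX) cos((2k + 1)X) to
    cos((2k + 4n + 1)X); a shift of k concludes. *)
Lemma cos4_theta n :
  cosz (4 * n) * qsum (fun k => q ^+ tri k * cosz (2 * k + 1)) =
  qsum (fun k => q ^+ tri (k - 2 * n) * cosz (2 * k + 1)).
Proof.
have fin s : qsummable (fun k => q ^+ tri k * trigz s (2 * k + 1)).
  by apply: (qsummable_int (C := 1)) => k; rewrite mul1n tri_ge.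
rewrite -[LHS]addr0 -[X in _ + X](mulr0 (- sinz (4 * n))) -qsum_sin_tri0.
rewrite !qsumM // -qsumD; try exact: qsummableM.
rewrite [RHS](qsum_reindex _ (bij_add (2 * n))); apply: eq_qsum => k.
rewrite addrK (_ : 2 * (k + 2 * n) + 1 = 4 * n + (2 * k + 1)); last by ring.
by rewrite (coszD (4 * n)); ring.
Qed.

(* The coefficient of cos((2l + 1)X) in the product of the two theta series. *)
Definition theta2_coef (l : int) : K :=
  qsum (fun n : int => q ^+ (sq n + tri (l - 2 * n)) * epsz _ n).

Lemma theta2_exp_ge n l :
  (`|n| <= sq n + tri (l - 2 * n))%N /\
  (`|l| <= 3 * (sq n + tri (l - 2 * n)).+1)%N.
Proof. by have := sq_ge n; have := tri_ge (l - 2 * n); lia. Qed.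

(** The factor free of X that is shared by all the coefficients [theta2_coef l]: the pentagonal
    series in q^2. *)
Let P := qsum (fun n : int => q ^+ pent2 n * epsz _ n).

Lemma P_summable : qsummable (fun n : int => q ^+ pent2 n * epsz _ n).
Proof.
by apply: (qsummable_int (C := 1)) => k; rewrite mul1n ltnW // ltnS pent2_ge.
Qed.

(** Under n -> l - n, twice the exponent is 2 (l - n)^2 + (l + 2n)(l + 2n + 1) = l (3l + 1) + 2n (3n
    + 1). *)
Lemma theta2_coef0 l :
  theta2_coef (3 * l) = q ^+ pent l * epsz _ l * P.
Proof.
rewrite /theta2_coef (qsum_reindex _ (bij_add l)).
rewrite (qsum_reindex _ bij_opp) /P qsumM; last exact: P_summable.
apply: eq_qsum => n; rewrite epszD epszN.
rewrite (_ : _ + tri _ = pent l + pent2 n)%N ?exprD; first by ring.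
by apply: addn_eq_double; rewrite triE pentE sqE pent2E; ring.
Qed.

(** Under n -> n + l the exponent splits likewise, with -l in place of l. *)
Lemma theta2_coefN1 l :
  theta2_coef (3 * l - 1) = q ^+ pent (- l) * epsz _ l * P.
Proof.
rewrite /theta2_coef (qsum_reindex _ (bij_add l)) /P qsumM; last exact: P_summable.
apply: eq_qsum => n; rewrite epszD.
rewrite (_ : _ + tri _ = pent (- l) + pent2 n)%N ?exprD; first by ring.
by apply: addn_eq_double; rewrite triE pentE sqE pent2E; ring.
Qed.

(** The reflection n -> 2l + 1 - n fixes the exponent and changes the parity of n, so the series
    equals its opposite. *)
Lemma theta2_coef1 l : theta2_coef (3 * l + 1) = 0.
Proof.
apply: eq_opp_0; rewrite [LHS](qsum_reindex _ (bij_refl (2 * l + 1))).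
rewrite -[RHS]mulN1r qsumM; last first.
  by apply: (qsummable_int (C := 1)) => n; rewrite mul1n leqW // (theta2_exp_ge n _).1.
apply: eq_qsum => n.
have -> : epsz K (2 * l + 1 - n) = - epsz _ n.
  rewrite (_ : 2 * l + 1 - n = l + l + (1 + - n)); last by ring.
  by rewrite !epszD epszM epszN epsz1; ring.
rewrite mulrN mulN1r; congr (- (_ ^+ _ * _)).
by apply: addn_eq_double; rewrite !triE !sqE; ring.
Qed.

Lemma theta2_mul :
  qsum (fun k : int => q ^+ tri k * cosz (2 * k + 1)) *
    qsum (fun n : int => q ^+ sq n * (epsz _ n * cosz (4 * n))) =
  qsum (fun l : int => cosz (2 * l + 1) * theta2_coef l).
Proof.
rewrite qsumM; last first.
  by apply: (qsummable_int (C := 1)) => n; rewrite mul1n leqW ?sq_ge.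
pose F n l := cosz (2 * l + 1) * (q ^+ (sq n + tri (l - 2 * n)) * epsz K n).
transitivity (qsum (fun n => qsum (F n))).
  apply: eq_qsum => n; rewrite mulrC -!mulrA cos4_theta mulrA qsumM.
    by apply: eq_qsum => l; rewrite /F exprD; ring.
  (* With t = tri(l - 2n): |l| <= 2|n| + t + 1 <= (2|n| + 1)(t + 1). *)
  apply: (qsummable_int (C := (2 * `|n|).+1)) => l.
  by have := tri_ge (l - 2 * n); move: (tri _) => t; nia.
rewrite qsum_exchange.
  apply: eq_qsum => l; rewrite /F -qsumM //.
  by apply: (qsummable_int (C := 1)) => n; rewrite mul1n leqW // (theta2_exp_ge n l).1.
move=> d; have [A dA] := int_ball d; have [B dB] := int_ball (3 * d.+1).
exists A, B => n l nl; apply: qdvdM.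
have : (d <= sq n + tri (l - 2 * n))%N.
  have := theta2_exp_ge n l; move: (sq n + tri _)%N => e [n_le l_le].
  by case/orP: nl => [/dA /leq_trans/(_ n_le)/ltnW //|/dB /leq_trans/(_ l_le)]; lia.
by move=> /subnKC <-; rewrite exprD -mulrA; apply: qdvd_qXn.
Qed.

(** Of the classes of l modulo 3, that of 1 vanishes; those of 0 and -1 are exchanged by l -> -l and
    contribute equally, whence the factor 2. *)
Lemma theta2_quintuple :
  qsum (fun k : int => q ^+ tri k * cosz (2 * k + 1)) *
    qsum (fun n : int => q ^+ sq n * (epsz _ n * cosz (4 * n))) =
  2 * (P * qsum (fun n : int => q ^+ pent n * (epsz _ n * cosz (6 * n + 1)))).
Proof.
have fin : qsummable (fun n : int => q ^+ pent n * (epsz _ n * cosz (6 * n + 1))).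
  by apply: (qsummable_int (C := 1)) => k; rewrite mul1n leqW ?pent_ge.
rewrite theta2_mul qsum_mod3; last first.
  move=> m; apply/fps_summableP => d; have [A dA] := int_ball (3 * d.+1).
  exists A => l /dA lt_l.
  suff: qdvd d.+1 (cosz (2 * l + 1) * theta2_coef l) by apply.
  apply/qdvdM/qdvd_qsum => n.
  have [_ /(leq_trans lt_l)] := theta2_exp_ge n l; rewrite ltn_mul2l /= ltnS.
  by move=> /subnKC <-; rewrite exprD -mulrA; apply: qdvd_qXn.
rewrite [X in _ + X](_ : _ = 0) ?addr0; last first.
  rewrite (eq_qsum (G := fun=> 0)) => [|n]; last by rewrite theta2_coef1 mulr0.
  by apply: fpsP => m; apply: fps_sum0.
rewrite mulr_natl mulr2n qsumM //; congr (_ + _).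
  apply: eq_qsum => n; rewrite theta2_coef0.
  by rewrite (_ : 2 * (3 * n) = 6 * n); ring.
rewrite (qsum_reindex _ bij_opp); apply: eq_qsum => n.
rewrite theta2_coefN1 opprK epszN (_ : 2 * (_ - 1) + 1 = - (6 * n + 1)); last by ring.
by rewrite coszN; ring.
Qed.

End QuintupleProduct.

(** * The two product formulas *)

Section GeneratingSeries.
Local Notation K := {fps {fps rat}}.
Let q : K := fpsC fpsX.
Let X : K := fpsX.

Definition U2_den : {fps rat} := fps_sum (fun n : nat =>
  (-1) ^+ n * (2 * n + 1)%:R * fpsX ^+ (n * (n + 1) %/ 2)).
Definition V2_den : {fps rat} := fps_sum (fun n : int =>
  (-1) ^ n * fpsX ^ (n * (3 * n + 1) %/ 2)%Z).

Lemma trigz_coef s k m n (y : {fps rat}) :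
  (q ^+ n * (fpsC y * trigz s k)) m =
  y * fpsC (s m / m`!%:R) * (k%:~R ^+ m * fpsX ^+ n).
Proof.
rewrite /q -rmorphXn mulrA -rmorphM fpsCME trigzE.
by rewrite mulrCA mulrA rmorphM rmorphM rmorphXn /= rmorph_int; ring.
Qed.

(** The denominator cancels the division in [U2]; what remains in degree 2t + 1 is the moment of
    order 2t + 1, as in the expansion of the sines. *)
Lemma U2_generating :
  fpsC U2_den * fps_sum (fun t : nat =>
    (-1) ^+ t * fpsC (U2 t) * (X ^+ (2 * t + 1) / ((2 * t + 1)`!)%:R)) =
  qsum (fun n : nat => q ^+ tri n%:Z * (epsz _ n%:Z * sinz (2 * n%:Z + 1))).
Proof.
rewrite (eq_fps_sum (fun t => trig_termE _ t _)) fps_sum_odd.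
apply: fpsP => m; rewrite fpsCME qsumE [fps_coef (Fps _) _]/=.
under eq_fps_sum => n do rewrite -(rmorph_epsz (@fpsC _)) trigz_coef /sin_sgn.
case: ifP => m_odd; last first.
  rewrite mulr0 (eq_fps_sum (G := fun=> 0)) ?fps_sum0 // => n.
  by rewrite mul0r rmorph0 mulr0 mul0r.
have mE : (2 * m./2 + 1)%N = m by lia.
rewrite (_ : _ * _ = (-1) ^+ m./2 * fpsC (m`!%:R)^-1 * (U2_den * U2 m./2)).
  rewrite /U2 mE [U2_den * _]mulrC divrK ?U2_unit // fps_sumM; last exact: U2_summable.
apply: eq_fps_sum => n; rewrite tri_nat /epsz /= !rmorphM rmorphXn rmorphN1 /=.
rewrite (_ : (2 * n%:Z + 1)%:~R = (2 * n + 1)%:R); last by rewrite -pmulrn; congr (_ %:R); lia.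
ring.
rewrite mE; ring.
Qed.

Lemma exprz_sign (R : comUnitRingType) (n : int) : (-1) ^ n = epsz R n.
Proof. by case: n => n //; rewrite NegzE -exprnN invr_sign /epsz abszN. Qed.

Lemma exprz_pent (n : int) :
  (fpsX : {fps rat}) ^ (n * (3 * n + 1) %/ 2)%Z = fpsX ^+ pent n.
Proof.
rewrite exprnP /pent; have [k _ ->] := pentagonal_ge n.
by [].
Qed.

Lemma V2_generating :
  fpsC V2_den * fps_sum (fun t : nat =>
    (-1) ^+ t * fpsC (V2 t) * (X ^+ (2 * t) / ((2 * t)`!)%:R)) =
  qsum (fun n : int => q ^+ pent n * (epsz _ n * cosz (6 * n + 1))).
Proof.
rewrite (eq_fps_sum (fun t => trig_termE _ t _)) fps_sum_even.
apply: fpsP => m; rewrite fpsCME qsumE [fps_coef (Fps _) _]/=.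
under eq_fps_sum => n do rewrite -(rmorph_epsz (@fpsC _)) trigz_coef /cos_sgn.
case: ifP => m_odd.
  rewrite mulr0 (eq_fps_sum (G := fun=> 0)) ?fps_sum0 // => n.
  by rewrite mul0r rmorph0 mulr0 mul0r.
have mE : (2 * m./2)%N = m by lia.
rewrite (_ : _ * _ = (-1) ^+ m./2 * fpsC (m`!%:R)^-1 * (V2_den * V2 m./2)).
  rewrite /V2 mE [V2_den * _]mulrC divrK ?V2_unit // fps_sumM; last exact: V2_summable.
  apply: eq_fps_sum => n; rewrite exprz_sign exprz_pent !rmorphM rmorphXn rmorphN1 /=.
  ring.
rewrite mE; ring.
Qed.

Lemma fps_prod0 (R : comNzRingType) (F : nat -> {fps R}) (r : seq nat) :
  (\prod_(j <- r) F j) 0%N = \prod_(j <- r) F j 0%N.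
Proof.
exact: (big_morph (fun p : {fps R} => p 0%N) (@fpsM0E R) (fps1E R 0)).
Qed.

(* A finite product identity known modulo q^N up to a factor free of X is
   normalized by comparing one coefficient in X on both sides. *)
Lemma qdvd_normalize N (a T : K) (b c p : {fps rat}) (k : nat) :
  qdvd N (a - fpsC b * T) -> a k = p -> T k = c ->
  qdvd N (fpsC c * a - fpsC p * T).
Proof.
move=> abT ak Tk; have := qdvd_coef k abT.
rewrite fpsBE fpsCME ak Tk rmorphB rmorphM => pbc.
rewrite (_ : _ - _ = fpsC c * (a - fpsC b * T) - T * (fpsC p - fpsC b * fpsC c)).
  by apply: qdvdB; apply: qdvdM.
ring.
Qed.

End GeneratingSeries.

Section MainProducts.
Local Notation K := {fps {fps rat}}.
Let q : K := fpsC fpsX.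
Let s := sinz 1.

Lemma tri_base (e : int -> K) :
  \sum_(k < 2) q ^+ tri (k%:Z - 1%:Z) * qbin (q ^+ 1) 1 k * e (k%:Z - 1%:Z) =
  e (- 1) + e 0.
Proof.
rewrite big_ord_recl big_ord1 /= qbin0 qbinS qbin0 qbin_small // mulr0 addr0 !mulr1.
by rewrite (_ : tri (0%:Z - 1%:Z) = 0%N) // !mul1r.
Qed.

Lemma sinz_0 k : sinz k 0%N = 0.
Proof. by rewrite trigzE mul0r rmorph0. Qed.

Lemma prod_coef0 (F : nat -> K) N :
  (forall j, F j 0%N = 1) -> (\prod_(1 <= j < N.+1) F j) 0%N = 1.
Proof. by move=> F1; rewrite fps_prod0 big1. Qed.

Lemma one_plus_sinz_coef0 k (y : K) : (1 + sinz k * y) 0%N = 1.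
Proof. by rewrite fpsDE fps1E fpsM0E sinz_0 mul0r addr0. Qed.

(** Removes the product p of the cleared denominators, a unit free of X. *)
Lemma qdvd_conclude N (c p : {fps rat}) (u P a T : K) :
  fpsC p \is a GRing.unit -> u = fpsC p * P ->
  qdvd N (fpsC c * (u * a) - fpsC p * T) -> qdvd N (fpsC c * a * P - T).
Proof.
move=> p_unit -> H; apply: (qdvd_unit p_unit).
by rewrite (_ : _ * _ = fpsC c * (fpsC p * P * a) - fpsC p * T) //; ring.
Qed.

(** Each partial product is compared with the theta series modulo q^N, then N tends to infinity. *)
Lemma U2_product :
  fpsC U2_den * s * fps2_prod (fun j => 1 + 4 * s ^+ 2 * q ^+ j / (1 - q ^+ j) ^+ 2) =
  qsum (fun n : nat => q ^+ tri n%:Z * (epsz _ n%:Z * sinz (2 * n%:Z + 1))).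
Proof.
apply: fps2_cvg_to_unique; first exact: fps2_prod_cvg1.
set T := qsum _ => N.
pose e (n : int) := epsz K n * sinz (2 * n + 1).
have e_rec n : e (n + 1) + e (n - 1) = - (2 * cosz 2) * e n.
  rewrite /e !epszD epszN epsz1.
  rewrite (_ : 2 * (n + 1) + 1 = 2 * n + 1 + 2); last by ring.
  rewrite (_ : 2 * (n - 1) + 1 = 2 * n + 1 - 2); last by ring.
  by rewrite !mulrN1 !mulNr -opprD -mulrDr sinzDB; ring.
(* The terms at n and -1 - n are equal, so the sum over all integers is twice the sum over n >=
   0. *)
have T2 : qsum (fun n : int => q ^+ tri n * e n) = 2 * T.
  rewrite qsum_int; last by apply: (qsummable_int (C := 1)) => n; rewrite mul1n tri_ge.
  rewrite mulr_natl mulr2n; congr (_ + _); apply: eq_qsum => n.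
  have -> : tri (- n.+1%:Z) = tri n by have := triE (- n.+1%:Z); have := triE n; lia.
  rewrite /e epszN (_ : n.+1%:Z = n%:Z + 1) ?epszD ?epsz1; last by lia.
  rewrite (_ : 2 * - (n%:Z + 1) + 1 = - (2 * n%:Z + 1)); last by ring.
  by rewrite sinzN; ring.
have T1 : T 1%N = U2_den.
  rewrite /T qsumE; apply: eq_fps_sum => n.
  rewrite -(rmorph_epsz (@fpsC _)) trigz_coef /sin_sgn /= divr1 rmorph1 mulr1 expr1 tri_nat mulrA.
  by congr (_ * _ * _); rewrite -pmulrn; congr (_ %:R); lia.
have [|||||beta] := @qsum_triple_product 1 1 1 (- (2 * cosz 2)) tri e N.
- by move=> n; have := triE n; have := triE (n + 1); lia.
- by [].
- by [].
- exact: tri_ge.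
- exact: e_rec.
rewrite tri_base T2 (_ : e _ + e _ = 2 * s); last first.
  have sN1 : sinz (2 * - 1 + 1) = - s by rewrite -sinzN.
  by rewrite /e /epsz expr0 expr1 mulr0 add0r sN1 /s; ring.
rewrite mulrCA (mulrCA (fpsC beta)) -mulrBr => /(qdvd_unit (fps2_nat_unit 1)).
set u := \prod_(_ <= _ < _) _ => uT.
(* The denominators cleared by passing to the factors 1 - 2 cos(2X) q^j + q^(2j). *)
pose p : {fps rat} := \prod_(1 <= j < N.+1) (1 - fpsX ^+ j) ^+ 2.
have pE : fpsC p = \prod_(1 <= j < N.+1) (1 - q ^+ j) ^+ 2.
  rewrite rmorph_prod; apply: eq_bigr => j _.
  by rewrite rmorphXn rmorphB rmorph1 rmorphXn.
have uE : u = fpsC p * \prod_(1 <= j < N.+1) (1 + 4 * s ^+ 2 * q ^+ j / (1 - q ^+ j) ^+ 2).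
  rewrite pE -big_split; apply: eq_big_nat => j /andP[j_gt0 _] /=.
  have /andP[qj_unit _] := fps2_1qn_unit j_gt0.
  rewrite mul1n addn1 prednK // mulrDr mulr1 [_ * (_ / _)]mulrCA divrr ?unitrX //.
  by rewrite mulr1 sinz_sqr -/q; ring.
have p_unit : fpsC p \is a GRing.unit.
  rewrite pE big_nat; apply: rpred_prod => j /andP[j_gt0 _].
  by have /andP[qj_unit _] := fps2_1qn_unit j_gt0; rewrite unitrX.
(* Coefficients of X are compared: sin X starts with X and the product with 1, so they are p on the
   left and [U2_den] in T. *)
apply: (qdvd_conclude p_unit uE); apply: (qdvd_normalize uT _ T1).
rewrite fpsME big_ord_recl big_ord1 sinz_0 mulr0 addr0 uE fpsCME prod_coef0 => [|j].
  by rewrite trigzE /sin_sgn /= mul1r divr1 expr1 rmorph1 !mulr1.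
rewrite expr2 (_ : 4 * _ * _ / _ = s * (4 * s * q ^+ j / (1 - q ^+ j) ^+ 2)).
  exact: one_plus_sinz_coef0.
ring.
Qed.

Lemma pent2_sum_const : exists a : {fps rat},
  qsum (fun n : int => q ^+ pent2 n * epsz _ n) = fpsC a.
Proof.
have E n : q ^+ pent2 n * epsz K n = fpsC (fpsX ^+ pent2 n * epsz _ n).
  by rewrite rmorphM rmorphXn rmorph_epsz.
exists (fps_sum (fun n => fpsX ^+ pent2 n * epsz _ n)).
rewrite (eq_qsum E); apply: fpsP => -[|m] //.
exact: fps_sum0.
Qed.

Lemma V2_product :
  fpsC V2_den * cosz 1 * fps2_prod (fun j =>
    (1 - 4 * s ^+ 2 * q ^+ j / (1 + q ^+ j) ^+ 2) *
    (1 + 4 * sinz 2 ^+ 2 * q ^+ (2 * j - 1) / (1 - q ^+ (2 * j - 1)) ^+ 2)) =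
  qsum (fun n : int => q ^+ pent n * (epsz _ n * cosz (6 * n + 1))).
Proof.
apply: fps2_cvg_to_unique; first exact: fps2_prod_cvg2.
set T := qsum _ => N.
pose F (j : nat) := (1 - 4 * s ^+ 2 * q ^+ j / (1 + q ^+ j) ^+ 2) *
  (1 + 4 * sinz 2 ^+ 2 * q ^+ (2 * j - 1) / (1 - q ^+ (2 * j - 1)) ^+ 2).
have T0 : T 0%N = V2_den.
  rewrite /T qsumE; apply: eq_fps_sum => n.
  by rewrite -(rmorph_epsz (@fpsC _)) trigz_coef /cos_sgn /= divr1 rmorph1 mulr1 mul1r exprz_sign exprz_pent.
(* [e1] yields the factors 1 + 2 cos(2X) q^j + q^(2j), and [e2] the factors 1 - 2 cos(4X) q^(2j - 1)
   + q^(4j - 2). *)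
pose e1 (n : int) := cosz (2 * n + 1).
pose e2 (n : int) := epsz K n * cosz (4 * n).
have [|||||beta1] := @qsum_triple_product 1 1 1 (2 * cosz 2) tri e1 N.
- by move=> n; have := triE n; have := triE (n + 1); lia.
- by [].
- by [].
- exact: tri_ge.
- move=> n; rewrite /e1 -coszDB; congr (cosz _ + cosz _); ring.
rewrite tri_base (_ : e1 _ + e1 _ = 2 * cosz 1); last first.
  have cN1 : cosz (2 * - 1 + 1) = cosz 1 by rewrite -[RHS]coszN.
  by rewrite /e1 mulr0 add0r cN1; ring.
have [|||||beta2] := @qsum_triple_product 2 1 0 (- (2 * cosz 4)) sq e2 N.
- by move=> n; rewrite !sqE; ring.
- by [].
- by [].
- by move=> n; apply: leqW; apply: sq_ge.
- move=> n; rewrite /e2 !epszD epszN epsz1 !mulrDr mulr1 !mulrN1.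
  by rewrite !mulNr -opprD -mulrDr coszDB; ring.
rewrite big_ord1 (_ : _ * e2 _ = 1); last first.
  by rewrite qbin0 mulr1 mul1r /e2 /epsz expr0 mul1r mulr0 cosz0.
rewrite mulr1; set u2 := \prod_(_ <= _ < _) _; set A2 := qsum _ => u2A.
set u1 := \prod_(_ <= _ < _) _; set A1 := qsum _ => u1A.
have [a aE] := pent2_sum_const.
have uT : qdvd N (u1 * u2 * cosz 1 - fpsC (beta1 * beta2 * a) * T).
  apply: (qdvd_unit (fps2_nat_unit 1)).
  have := theta2_quintuple; rewrite aE -/T -/A1 -/A2 => A12.
  (* The two congruences are multiplied; [theta2_quintuple] then replaces A1 A2 by 2 a T. *)
  rewrite (_ : _ * _ = u2 * (u1 * (2 * cosz 1) - fpsC beta1 * A1)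
    + fpsC beta1 * A1 * (u2 - fpsC beta2 * A2)).
    by apply: qdvdD; apply: qdvdM.
  rewrite !rmorphM.
  rewrite (_ : 2 * _ = 2 * u1 * u2 * cosz 1 - fpsC beta1 * fpsC beta2 * (2 * (fpsC a * T))).
    by rewrite -A12; ring.
  ring.
pose p : {fps rat} := \prod_(1 <= j < N.+1)
  ((1 + fpsX ^+ j) ^+ 2 * (1 - fpsX ^+ (2 * j - 1)) ^+ 2).
have pE : fpsC p =
    \prod_(1 <= j < N.+1) ((1 + q ^+ j) ^+ 2 * (1 - q ^+ (2 * j - 1)) ^+ 2).
  rewrite rmorph_prod; apply: eq_bigr => j _.
  by rewrite rmorphM !rmorphXn rmorphD rmorphB rmorph1 !rmorphXn.
have units j : (0 < j)%N -> ((1 + q ^+ j) ^+ 2 \is a GRing.unit) &&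
    ((1 - q ^+ (2 * j - 1)) ^+ 2 \is a GRing.unit).
  move=> j_gt0; have /andP[_ U1] := fps2_1qn_unit j_gt0.
  have j2_gt0 : (0 < 2 * j - 1)%N by lia.
  by have /andP[U2 _] := fps2_1qn_unit j2_gt0; rewrite !unitrX.
have p_unit : fpsC p \is a GRing.unit.
  rewrite pE big_nat; apply: rpred_prod => j /andP[j_gt0 _].
  by have /andP[U1 U2] := units j j_gt0; rewrite unitrM U1.
have uE : u1 * u2 = fpsC p * \prod_(1 <= j < N.+1) F j.
  rewrite pE -!big_split; apply: eq_big_nat => j /andP[j_gt0 _] /=.
  have /andP[U1 U2] := units j j_gt0; rewrite /F [RHS]mulrACA; congr (_ * _).
    rewrite mul1n addn1 prednK // mulrBr mulr1 [_ * (_ / _)]mulrCA divrr //.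
    by rewrite mulr1 sinz_sqr -/q; ring.
  rewrite (_ : 2 * j.-1 + 1 = 2 * j - 1)%N; last by lia.
  rewrite mulrDr mulr1 [_ * (_ / _)]mulrCA divrr //.
  by rewrite mulr1 sinz_sqr -/q; ring.
(* Constant coefficients in X are compared: cos X and every factor of the product have 1, since the
   sines vanish there. *)
apply: (qdvd_conclude p_unit uE); apply: (qdvd_normalize uT _ T0).
rewrite fpsM0E uE fpsCME prod_coef0 => [|j].
  by rewrite trigzE /cos_sgn /= mul1r divr1 expr0 rmorph1 !mulr1.
rewrite /F fpsM0E !expr2.
rewrite (_ : 1 - _ = 1 + s * (- (4 * s * q ^+ j / ((1 + q ^+ j) * (1 + q ^+ j))))); last by ring.
rewrite (_ : 4 * (sinz 2 * _) * _ / _ = sinz 2 * (4 * sinz 2 * q ^+ (2 * j - 1) /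
  ((1 - q ^+ (2 * j - 1)) * (1 - q ^+ (2 * j - 1))))); last by ring.
by rewrite !one_plus_sinz_coef0 mulr1.
Qed.

End MainProducts.

Theorem theorem3p3 :
  let q : {fps {fps rat}} := fpsC fpsX in
  let X : {fps {fps rat}} := fpsX in
  fps_sum (fun t : nat =>
      (-1) ^+ t * fpsC (U2 t) * (X ^+ (2 * t + 1) / ((2 * t + 1)`!)%:R)) =
    fps_sin X *
    fps2_prod (fun j => 1 + 4 * fps_sin X ^+ 2 * q ^+ j / (1 - q ^+ j) ^+ 2)
  /\
  fps_sum (fun t : nat =>
      (-1) ^+ t * fpsC (V2 t) * (X ^+ (2 * t) / ((2 * t)`!)%:R)) =
    fps_cos X *
    fps2_prod (fun j =>
      (1 - 4 * fps_sin X ^+ 2 * q ^+ j / (1 + q ^+ j) ^+ 2) *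
      (1 + 4 * fps_sin (2 * X) ^+ 2 * q ^+ (2 * j - 1) /
             (1 - q ^+ (2 * j - 1)) ^+ 2)).
Proof.
move=> q X.
have sin1 : fps_sin X = sinz 1 by rewrite -fps_sin_int mul1r.
have cos1 : fps_cos X = cosz 1 by rewrite -fps_cos_int mul1r.
have sin2 : fps_sin (2 * X) = sinz 2 by rewrite -fps_sin_int.
have U_unit : fpsC U2_den \is a GRing.unit by rewrite fps_unitE; exact: U2_unit.
have V_unit : fpsC V2_den \is a GRing.unit by rewrite fps_unitE; exact: V2_unit.
(* Each identity is checked after multiplication by its denominator, a unit; both sides then equal
   the same theta series. *)
rewrite sin1 cos1 sin2; split.
  by apply: (mulrI U_unit); rewrite U2_generating mulrA U2_product.
by apply: (mulrI V_unit); rewrite V2_generating mulrA V2_product.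
Qed.
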